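(* Let $n\geq 2$ be an integer. Then there exists an $n$-dimensional complete Kähler manifold $M$ with semi-positive holomorphic sectional curvature such that $r^+_M=\lfloor\frac{n+1}{2}\rfloor$. Furthermore, $M$ can be chosen so that, as a complex manifold, it can be compactified to a compact complex manifold with ample anti-canonical line bundle.
   Context: Let $(M,g)$ be a Hermitian manifold of complex dimension $n$, with $g=\sum g_{i\bar j}\,dz_i\otimes d\bar z_j$ in local holomorphic coordinates. The curvature tensor of the Hermitian (Chern) connection has components $$R_{i\bar j k\bar l}=-\frac{\partial^2 g_{i\bar j}}{\partial z_k\partial\bar z_l}+\sum_{p,q} g^{p\bar q}\frac{\partial g_{i\bar p}}{\partial z_k}\frac{\partial g_{q\bar j}}{\partial \bar z_l}.$$ The holomorphic sectional curvature of a non-zero tangent vector $\xi=\sum_i\xi_i\frac{\partial}{\partial z_i}\in T_pM$ (holomorphic tangent space) is $$H(\xi)=\Big(\sum R_{i\bar jk\bar l}(p)\,\xi_i\bar\xi_j\xi_k\bar\xi_l\Big)\Big/\Big(\sum g_{i\bar j}g_{k\bar l}\,\xi_i\bar\xi_j\xi_k\bar\xi_l\Big).$$ It is semi-positive if $H(\xi)\ge 0$ for all non-zero tangent vectors $\xi$ at all points. Rank invariant: let $M$ be a Hermitian manifold with semi-positive holomorphic sectional curvature $H$ and $n=\dim M$. For $p\in M$, let $\eta(p)$ be the maximum of those integers $k\in\{0,\ldots,n\}$ such that there exists a $k$-dimensional complex subspace $L\subset T_pM$ with $H(v)=0$ for all $v\in L\setminus\{0\}$. Set $\eta_M:=\min_{p\in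 M}\eta(p)$ and $r^+_M:=n-\eta_M$. ''$M$ can be compactified to a compact complex manifold $X$'' means that $M$ is biholomorphic to a dense open subset of $X$ (no condition is imposed on extending the metric). *)

(* Defs.v *)
From HB Require Import structures.
From mathcomp Require Import all_boot all_order all_algebra complex.
From mathcomp Require Import all_classical all_reals all_analysis.
Import Order.TTheory GRing.Theory Num.Theory numFieldNormedType.Exports.

Set Implicit Arguments.
Unset Strict Implicit.
Unset Printing Implicit Defensive.

Local Open Scope classical_set_scope.
Local Open Scope ring_scope.

(* R[i] seen as a [numClosedFieldType], which is what gives it (and the spaces
   'rV_n over it) the norm topology.  [differentiable] for maps between such
   spaces means Frechet differentiable over the complex numbers, so that, on
   open sets, it is holomorphy.  The order on [cplx R] is the partial one:
   [0 <= z] says that [z] is real and nonnegative. *)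
Definition cplx (R : realType) : numClosedFieldType := R[i].

Definition imu (R : realType) : cplx R := Complex (0 : R) (1 : R).

(** * Complex manifolds *)

(* Connected Hausdorff second countable spaces with a holomorphic atlas.
   [chart a] and [chart_inv a] are only meaningful on the open sets [dom a] and
   [chart a @` dom a].  [chart_at p] is a preferred chart around [p]; a tangent
   vector at [p] is represented by the row of its components in that chart. *)
Record complexManifold (R : realType) (n : nat) := ComplexManifold {
  carrier :> topologicalType ;
  carrier_neq0 : [set: carrier] !=set0 ;
  carrier_hausdorff : hausdorff_space carrier ;
  carrier_second_countable : @second_countable carrier ;
  carrier_connected : connected [set: carrier] ;
  chart_index : Type ;
  dom : chart_index -> set carrier ;
  chart : chart_index -> carrier -> 'rV[cplx R]_n ;
  chart_inv : chart_index -> 'rV[cplx R]_n -> carrier ;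
  chart_at : carrier -> chart_index ;
  dom_chart_at : forall p, dom (chart_at p) p ;
  dom_open : forall a, open (dom a) ;
  chart_open : forall a, open (chart a @` dom a) ;
  chartK : forall a p, dom a p -> chart_inv a (chart a p) = p ;
  chart_continuous : forall a p, dom a p -> {for p, continuous (chart a)} ;
  chart_inv_continuous : forall a z, (chart a @` dom a) z ->
    {for z, continuous (chart_inv a)} ;
  chart_holomorphic : forall a b p, dom a p -> dom b p ->
    differentiable (chart a \o chart_inv b) (chart b p)
}.

Arguments dom {R n c} _ _.
Arguments chart {R n c} _ _.
Arguments chart_inv {R n c} _ _.
Arguments chart_at {R n c} _.

Definition holomorphic_at (R : realType) (m n : nat) (M : complexManifold R m)
    (X : complexManifold R n) (f : M -> X) (p : M) : Prop :=
  {for p, continuous f} /\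
  forall a b, dom a p -> dom b (f p) ->
    differentiable (chart b \o f \o chart_inv a) (chart a p).

(* [f] is a biholomorphism, with inverse [h], from [M] onto a dense open subset
   of the compact manifold [X]. *)
Definition compactifies (R : realType) (n : nat) (M X : complexManifold R n) :
    Prop :=
  compact [set: X] /\
  exists (f : M -> X) (h : X -> M),
    [/\ open (range f) /\ dense (range f),
        forall p, h (f p) = p,
        forall p, holomorphic_at f p &
        forall x, range f x -> holomorphic_at h x].

(** * Line bundles *)

Section line_bundles.
Context {R : realType} {n : nat} (X : complexManifold R n).
Local Notation C := (cplx R).

(* A line bundle trivialized over the charts of [X] is described by its
   transition functions; a section with components [s a] satisfies
   [s a = t a b * s b] over [dom a `&` dom b]. *)
Definition transitions := chart_index X -> chart_index X -> X -> C.

(* With respect to the frames d/dz_1 /\ ... /\ d/dz_n of the top exterior power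
   of the holomorphic tangent bundle. *)
Definition anticanonical : transitions :=
  fun a b p => \det (jacobian (chart a \o chart_inv b) (chart b p)).

Definition tensor_power (t : transitions) (m : nat) : transitions :=
  fun a b p => t a b p ^+ m.

Definition holomorphic_section (t : transitions)
    (s : chart_index X -> X -> C) : Prop :=
  (forall a p, dom a p -> differentiable (s a \o chart_inv a) (chart a p)) /\
  (forall a b p, dom a p -> dom b p -> s a p = t a b p * s b p).

(* The sections s_0, ..., s_N have no common zero, and p |-> [s_0 : ... : s_N]
   is an injective immersion into projective N-space, the differential being
   computed in the affine chart where the homogeneous coordinate k0 is nonzero.
   This is only used for compact [X], where an injective immersion is an
   embedding. *)
Definition very_ample (t : transitions) : Prop :=
  exists (N : nat) (s : 'I_N.+1 -> chart_index X -> X -> C),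
    [/\ forall k, holomorphic_section t (s k),
        forall p, exists k, s k (chart_at p) p != 0,
        forall p q, (exists2 c : C, c != 0 &
            forall k, s k (chart_at p) p = c * s k (chart_at q) q) -> p = q &
        forall p k0, s k0 (chart_at p) p != 0 ->
          row_free (jacobian
            (fun z => \row_k (s k (chart_at p) (chart_inv (chart_at p) z) /
                              s k0 (chart_at p) (chart_inv (chart_at p) z)))
            (chart (chart_at p) p))].

Definition ample (t : transitions) : Prop :=
  exists2 m : nat, (0 < m)%N & very_ample (tensor_power t m).

End line_bundles.

Arguments anticanonical {R n} X _ _ _.

(** * Real and Wirtinger derivatives *)

Section derivatives.
Context {R : realType}.
Local Notation C := (cplx R).

Definition cderivable1 (c : R -> C) (t : R) : Prop :=
  derivable (fun s => complex.Re (c s)) t 1 /\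
  derivable (fun s => complex.Im (c s)) t 1.

Definition cderive1 (c : R -> C) (t : R) : C :=
  Complex (derive1 (fun s => complex.Re (c s)) t)
          (derive1 (fun s => complex.Im (c s)) t).

Context {n : nat}.
Implicit Types (f : 'rV[C]_n -> C) (z v : 'rV[C]_n).

Definition rline f z v : R -> C := fun t => f (z + (t%:C%C : C) *: v).

(* Derivative of [f] along the real direction [v] of C^n = R^2n. *)
Definition rderive v f z : C := cderive1 (rline f z v) 0.

Fixpoint Ck (k : nat) (U : set 'rV[C]_n) f : Prop :=
  (forall z, U z -> {for z, continuous f}) /\
  (if k is k'.+1 then
     forall v, (forall z, U z -> cderivable1 (rline f z v) 0) /\
               Ck k' U (rderive v f)
   else True).

Definition smooth (U : set 'rV[C]_n) f : Prop := forall k, Ck k U f.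

(* d/dz_k = (d/dx_k - i d/dy_k) / 2  and  d/dzbar_k = (d/dx_k + i d/dy_k) / 2 *)
Definition dz (k : 'I_n) f z : C :=
  (rderive (delta_mx 0 k) f z - imu R * rderive (imu R *: delta_mx 0 k) f z) / 2.

Definition dzbar (k : 'I_n) f z : C :=
  (rderive (delta_mx 0 k) f z + imu R * rderive (imu R *: delta_mx 0 k) f z) / 2.

End derivatives.

(** * Hermitian metrics and holomorphic sectional curvature *)

(* [gmx a z i j] is the coefficient g_{i jbar} of the metric in the chart [a],
   at the point of coordinates [z].  As vectors are rows, components transform
   by right multiplication by the (complex) jacobian. *)
Record hermitianMetric (R : realType) (n : nat) (M : complexManifold R n) :=
  HermitianMetric {
  gmx : chart_index M -> 'rV[cplx R]_n -> 'M[cplx R]_n ;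
  gmx_smooth : forall a i j,
    smooth (chart a @` dom a) (fun z => gmx a z i j) ;
  gmx_hermitian : forall a z i j, (chart a @` dom a) z ->
    gmx a z j i = (gmx a z i j)^* ;
  gmx_pos : forall a z (v : 'rV[cplx R]_n), (chart a @` dom a) z -> v != 0 ->
    0 < \sum_i \sum_j gmx a z i j * v 0 i * (v 0 j)^* ;
  gmx_change : forall a b p, dom a p -> dom b p ->
    let J := jacobian (chart a \o chart_inv b) (chart b p) in
    gmx b (chart b p) = J *m gmx a (chart a p) *m (map_mx Num.conj J)^T
}.

Section hermitian.
Context {R : realType} {n : nat} {M : complexManifold R n}.
Variable g : hermitianMetric M.
Local Notation C := (cplx R).

(* The vanishing of the (2,1) and (1,2) components of the exterior derivative of
   the fundamental form i sum g_{i jbar} dz_i /\ dzbar_j (up to a constant). *)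
Definition kahler : Prop :=
  forall (a : chart_index M) z, (chart a @` dom a) z -> forall i j k,
    dz k (fun w => gmx g a w i j) z = dz i (fun w => gmx g a w k j) z /\
    dzbar k (fun w => gmx g a w i j) z = dzbar j (fun w => gmx g a w i k) z.

(* Here g^{p qbar} is the (p, q) entry of the inverse of the matrix (g_{i jbar}):
   as matrices in (i, j), R = - d_k dbar_l G + (d_k G) G^-1 (dbar_l G). *)
Definition curvature (a : chart_index M) (z : 'rV[C]_n) (i j k l : 'I_n) : C :=
  - dz k (dzbar l (fun w => gmx g a w i j)) z +
  \sum_p \sum_q invmx (gmx g a z) p q *
    dz k (fun w => gmx g a w i p) z * dzbar l (fun w => gmx g a w q j) z.

Definition hsc (p : M) (v : 'rV[C]_n) : C :=
  let a := chart_at p in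
  let z := chart a p in
  (\sum_i \sum_j \sum_k \sum_l
     curvature a z i j k l * v 0 i * (v 0 j)^* * v 0 k * (v 0 l)^*) /
  (\sum_i \sum_j \sum_k \sum_l
     gmx g a z i j * gmx g a z k l * v 0 i * (v 0 j)^* * v 0 k * (v 0 l)^*).

Definition semipositive_hsc : Prop := forall p v, v != 0 -> 0 <= hsc p v.

Definition has_hsc_flat (p : M) (k : nat) : Prop :=
  exists2 L : {vspace 'rV[C]_n}, \dim L = k &
    forall v, v \in L -> v != 0 -> hsc p v = 0.

Definition eta (p : M) : nat :=
  (\max_(k < n.+1 | `[< has_hsc_flat p k >]) k)%N.

Lemma eta_attained : exists m, [pred m | `[< exists p, eta p = m >]] m.
Proof.
by case: (carrier_neq0 M) => p _; exists (eta p); apply/asboolP; exists p.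
Qed.

Definition eta_min : nat := ex_minn eta_attained.

Definition rplus : nat := (n - eta_min)%N.

(** * Riemannian distance and completeness *)

Definition C1_at (c : R -> M) (t : R) : Prop :=
  {for t, continuous c} /\
  forall a j, dom a (c t) ->
    let x := fun s => chart a (c s) 0 j in
    (\forall s \near t, cderivable1 x s) /\ {for t, continuous (cderive1 x)}.

Definition speed (c : R -> M) (t : R) : R :=
  let a := chart_at (c t) in
  let v j := cderive1 (fun s => chart a (c s) 0 j) t in
  Num.sqrt (complex.Re
    (\sum_i \sum_j gmx g a (chart a (c t)) i j * v i * (v j)^*)).

Definition curve_length (c : R -> M) : \bar R :=
  (\int[lebesgue_measure]_(t in `[0%R, 1%R]) (speed c t)%:E)%E.

(* Paths need not be regular, so taking C^1 rather than piecewise C^1 ones does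
   not change the infimum; a C^1 path on [0, 1] extends to a neighbourhood. *)
Definition gdist (p q : M) : \bar R :=
  ereal_inf [set curve_length c | c in
    [set c | (forall t, 0 <= t <= 1 -> C1_at c t) /\ c 0 = p /\ c 1 = q]].

Definition complete_metric : Prop :=
  forall u : nat -> M,
    (forall e : R, 0 < e -> exists N : nat, forall i j : nat,
       (N <= i)%N -> (N <= j)%N -> (gdist (u i) (u j) < e%:E)%E) ->
    exists x : M, forall e : R, 0 < e -> exists N : nat, forall i : nat,
       (N <= i)%N -> (gdist (u i) x < e%:E)%E.

End hermitian.

(* Main.v *)
(* M is C^n with the product metric which is the cigar metric
   |dz|^2 / (1 + |z|^2) on floor((n + 1) / 2) of the coordinates and the flat
   metric |dz|^2 on the others.  With q_i = 1 / (1 + b_i |z_i|^2), where b_i = 1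
   on cigar coordinates and 0 on flat ones, the only nonzero curvature
   components are R_iiii = b_i q_i^3.  Hence H(v) is proportional to
   sum_i b_i q_i^3 |v_i|^4: it is nonnegative, and it vanishes exactly when the
   cigar components of v do, so that eta(p) is the number of flat coordinates at
   every point.
   For completeness, with D = 1 + b_i |z_i|^2, the functions ln D and z_i / D are
   Lipschitz for the distance of g, and they determine z_i.  A Cauchy sequence
   thus converges in C^n, and then also for g, which is at most the flat metric.
   M is an affine chart of X = (P^1)^n, whose anticanonical bundle O(2, ..., 2)
   is very ample: its monomial sections embed X. *)
Require Import Defs.
From HB Require Import structures.
From mathcomp Require Import all_boot all_order all_algebra complex.
From mathcomp Require Import all_classical all_reals all_analysis.
From mathcomp Require Import measurable_realfun ring lra.
Import Order.TTheory GRing.Theory Num.Theory numFieldNormedType.Exports.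

Set Implicit Arguments.
Unset Strict Implicit.
Unset Printing Implicit Defensive.

Local Open Scope classical_set_scope.
Local Open Scope ring_scope.

(** * Topology of complex row spaces *)

Section complex_topology.
Context {R : realType}.
Local Notation C := (cplx R).
Implicit Types (z w : C) (x y : R).

(** The coordinates z_i are not Lipschitz in a cigar factor, where dz has length |dz| / sqrt(1 +
    |z|^2), so a Cauchy sequence must first be kept from escaping to infinity. The function ln D
    grows like 2 ln |z|, that is, like twice the distance to the origin: it is a Lipschitz function
    that controls |z|. Dividing z_i by D makes it Lipschitz, and multiplying by exp (ln D) restores
    it. No geodesic is involved. Smoothness of the metric concerns all iterated derivatives in real
    directions. It reduces to a closure property: for q = 1 / (1 + b |z|^2) one has dq = - b q^2
    (zbar dz + z dzbar), so polynomials in the z_i, their conjugates and the q_i are stable under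
    differentiation. The same symbolic calculus yields the Wirtinger derivatives in the curvature.
    The numerator of H is a sum of nonnegative terms, one for each cigar coordinate; its zeros
    therefore form a linear subspace, and no search for a maximal flat subspace is necessary. Any
    number of cigar coordinates is realized as a rank in this way; the value floor((n + 1) / 2)
    enters only with the final choice of b. *)

Lemma Re_add z w : complex.Re (z + w) = complex.Re z + complex.Re w.
Proof. by case: z w => [a b] [c d]. Qed.

Lemma Im_add z w : complex.Im (z + w) = complex.Im z + complex.Im w.
Proof. by case: z w => [a b] [c d]. Qed.

Lemma Re_sub z w : complex.Re (z - w) = complex.Re z - complex.Re w.
Proof. by case: z w => [a b] [c d]. Qed.

Lemma Im_sub z w : complex.Im (z - w) = complex.Im z - complex.Im w.
Proof. by case: z w => [a b] [c d]. Qed.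

Lemma Re_mul z w : complex.Re (z * w) =
  complex.Re z * complex.Re w - complex.Im z * complex.Im w.
Proof. by case: z w => [a b] [c d]. Qed.

Lemma Im_mul z w : complex.Im (z * w) =
  complex.Re z * complex.Im w + complex.Im z * complex.Re w.
Proof. by case: z w => [a b] [c d]. Qed.

Lemma cRe_conj z : complex.Re (Num.conj z) = complex.Re z.
Proof. by case: z => [a b]. Qed.

Lemma cIm_conj z : complex.Im (Num.conj z) = - complex.Im z.
Proof. by case: z => [a b]. Qed.

Lemma norm_Re_le z : `|complex.Re z|%:C%C <= `|z|.
Proof. exact: normc_ge_Re. Qed.

Lemma norm_Im_le z : `|complex.Im z|%:C%C <= `|z|.
Proof.
case: z => a b; rewrite normc_def lecR /= -[leLHS]sqrtr_sqr ler_wsqrtr//.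
by rewrite lerDr sqr_ge0.
Qed.

Lemma norm_le_ReIm z : `|z| <= (`|complex.Re z| + `|complex.Im z|)%:C%C.
Proof.
case: z => a b; rewrite normc_def lecR /= -[leRHS]ger0_norm ?addr_ge0//.
rewrite -sqrtr_sqr ler_wsqrtr// sqrrD !real_normK ?num_real//.
by rewrite addrAC lerDl mulrn_wge0// mulr_ge0.
Qed.

Lemma posC_ex z : 0 < z -> exists2 e : R, 0 < e & z = e%:C%C.
Proof. by case: z => a b; rewrite ltcE /= => /andP[/eqP -> a0]; exists a. Qed.

(** The norm on [cplx R] takes values in the partially ordered complex numbers. Passing to real
    boxes lets topological facts be deduced from those on R. *)
Lemma nbhs_cplxP z (A : set C) : nbhs z A <->
  exists2 e : R, 0 < e & forall w, `|complex.Re (z - w)| < e ->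
    `|complex.Im (z - w)| < e -> A w.
Proof.
split.
  move=> /nbhs_ballP[e0 /= /posC_ex[e e_gt0 ->] eA].
  exists (e / 2); first by rewrite divr_gt0.
  move=> w zw1 zw2; apply: eA; rewrite -ball_normE /ball_ /=.
  by rewrite (le_lt_trans (norm_le_ReIm _))// ltcR (splitr e) ltrD.
move=> [e e0 eA]; apply/nbhs_ballP; exists e%:C%C; first by rewrite /= ltcR.
move=> w; rewrite -ball_normE /ball_ /= => zw.
by apply: eA; rewrite -ltcR; apply: le_lt_trans zw; [exact: norm_Re_le|exact: norm_Im_le].
Qed.

Lemma Re_continuous : continuous (@complex.Re R : C -> R).
Proof.
move=> z; apply/(@cvgrPdist_lt R R^o C (nbhs z) _) => e e0; apply/nbhs_cplxP; exists e => // w.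
by rewrite Re_sub.
Qed.

Lemma Im_continuous : continuous (@complex.Im R : C -> R).
Proof.
move=> z; apply/(@cvgrPdist_lt R R^o C (nbhs z) _) => e e0; apply/nbhs_cplxP; exists e => // w _.
by rewrite Im_sub.
Qed.

Lemma cvg_Complex (T : Type) (F : set_system T) (FF : Filter F) (f g : T -> R) x y :
  f @ F --> x -> g @ F --> y -> (fun t => Complex (f t) (g t) : C) @ F --> (Complex x y : C).
Proof.
move=> fx gy A /nbhs_cplxP[e e0 eA].
move/cvgrPdist_lt : fx => /(_ _ e0) fx; move/cvgrPdist_lt : gy => /(_ _ e0) gy.
near=> t; apply: eA => /=.
  by near: t; exact: fx.
by near: t; exact: gy.
Unshelve. all: by end_near. Qed.

Lemma Complex_continuous (T : topologicalType) (f g : T -> R) (t : T) :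
  {for t, continuous f} -> {for t, continuous g} ->
  {for t, continuous (fun t => Complex (f t) (g t) : C)}.
Proof. by move=> ft gt; exact: (@cvg_Complex T (nbhs t) _ f g). Qed.

Lemma real_complex_continuous : continuous (fun x => x%:C%C : C).
Proof. by move=> x; apply: Complex_continuous; [exact: cvg_id|exact: cvg_cst]. Qed.

Lemma conj_continuous : continuous (Num.conj : C -> C).
Proof.
rewrite (_ : Num.conj = fun z => Complex (complex.Re z) (- complex.Im z) : C).
  move=> z; apply: Complex_continuous; first exact: Re_continuous.
  by apply: (@cvgN _ R^o C (nbhs z) _); exact: Im_continuous.
by apply/funext => -[a b].
Qed.

Lemma compact_box (M : R) :
  compact [set z : C | `|complex.Re z| <= M /\ `|complex.Im z| <= M].
Proof.
have := compact_setX (@segment_compact R (- M) M) (@segment_compact R (- M) M).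
pose f (p : R * R) : C := Complex p.1 p.2.
move=> /(continuous_compact (f := f)); rewrite (_ : f @` _ =
  [set z : C | `|complex.Re z| <= M /\ `|complex.Im z| <= M]).
  apply; apply: continuous_subspaceT => p.
  by apply: Complex_continuous; [exact: cvg_fst|exact: cvg_snd].
apply/seteqP; split => [_ [[a b] /= [aM bM] <-]|[a b] /= [aM bM]].
  by move: aM bM; rewrite !in_itv /= -!ler_norml.
by exists (a, b) => //; split; rewrite /= in_itv /= -ler_norml.
Qed.

Lemma cplx_hausdorff : hausdorff_space C.
Proof. exact: norm_hausdorff. Qed.

Lemma closed_box (M : R) :
  closed [set z : C | `|complex.Re z| <= M /\ `|complex.Im z| <= M].
Proof. by apply: compact_closed; [exact: cplx_hausdorff|exact: compact_box]. Qed.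

(** Local compactness is what makes the one-point compactification Hausdorff. *)
Lemma cplx_locally_compact : locally_compact [set: C].
Proof.
move=> z _; pose M := `|complex.Re z| + `|complex.Im z| + 1.
exists [set z : C | `|complex.Re z| <= M /\ `|complex.Im z| <= M]; last first.
  by split; [exact: compact_box|exact: closed_box].
rewrite withinET; apply/nbhs_cplxP; exists 1 => // w zw1 zw2.
have {}zw1 : `|complex.Re w| <= `|complex.Re z| + 1.
  rewrite -[w in leLHS](subKr z) Re_sub (le_trans (ler_normB _ _))// lerD2l.
  exact: ltW.
have {}zw2 : `|complex.Im w| <= `|complex.Im z| + 1.
  rewrite -[w in leLHS](subKr z) Im_sub (le_trans (ler_normB _ _))// lerD2l.
  exact: ltW.
rewrite /M; split.
  by apply: le_trans zw1 _; rewrite -addrA lerD2l lerDr.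
by apply: le_trans zw2 _; rewrite -addrA lerDr.
Qed.

Lemma compact_bounded_cplx (K : set C) : compact K ->
  exists2 B : R, 0 < B & forall z, K z -> `|z| <= B%:C%C.
Proof.
have bound (f : C -> R) : continuous f -> compact K ->
    exists2 B : R, 0 < B & forall z, K z -> `|f z| <= B.
  move=> cf /(continuous_compact (continuous_subspaceT cf)) /compact_bounded[B [_ HB]].
  exists (`|B| + 1) => [|z Kz]; first by rewrite ltr_wpDl.
  by apply: (HB (`|B| + 1)); [rewrite (le_lt_trans (ler_norm _))// ltrDl|exists z].
move=> cK; have [B1 B10 HB1] := bound _ Re_continuous cK.
have [B2 B20 HB2] := bound _ Im_continuous cK.
exists (B1 + B2) => [|z Kz]; first exact: addr_gt0.
by apply: le_trans (norm_le_ReIm z) _; rewrite lecR lerD ?HB1 ?HB2.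
Qed.

End complex_topology.

Section row_topology.
Context {n : nat} {T : topologicalType}.
Implicit Types (v w : 'rV[T]_n) (A : set 'rV[T]_n).

Lemma rV_nbhsP v A : nbhs v A <-> exists2 P : 'I_n -> set T,
  forall i, nbhs (v 0 i) (P i) & forall w, (forall i, P i (w 0 i)) -> A w.
Proof.
split=> [[P vP PA]|[P vP PA]].
  exists (P 0) => [i|w wP]; first exact: vP.
  by apply: PA => i j; rewrite ord1.
exists (fun=> P) => [i j|w wP]; first by rewrite ord1.
by apply: PA => i; exact: wP.
Qed.

Lemma rV_coord_continuous i : continuous (fun v => v 0 i).
Proof.
move=> v A vA; apply/rV_nbhsP.
exists (fun j => if j == i then A else setT) => [j|w].
  by case: eqP => [->//|_]; exact: filterT.
by move=> /(_ i); rewrite eqxx.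
Qed.

Lemma cvg_rV (S : Type) (F : set_system S) (FF : Filter F) (f : S -> 'rV[T]_n) v :
  (forall i, (fun s => f s 0 i) @ F --> v 0 i) -> f @ F --> v.
Proof.
move=> fv A /rV_nbhsP[P vP PA].
have : \forall s \near F, forall i, P i (f s 0 i).
  by apply: filter_forall => i; exact: fv (vP i).
by apply: filterS => s; exact: PA.
Qed.

Lemma rV_continuous (S : topologicalType) (f : S -> 'rV[T]_n) s :
  (forall i, {for s, continuous (fun s => f s 0 i)}) -> {for s, continuous f}.
Proof. by move=> fc; apply: (@cvg_rV _ (nbhs s)). Qed.

Lemma open_box (U : 'I_n -> set T) : (forall i, open (U i)) ->
  open [set v : 'rV[T]_n | forall i, U i (v 0 i)].
Proof.
move=> oU; rewrite openE => v Uv; apply/rV_nbhsP; exists U => // i.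
by apply: open_nbhs_nbhs; split.
Qed.

Lemma rV_hausdorff : hausdorff_space T -> hausdorff_space 'rV[T]_n.
Proof.
move=> hT v w vw; apply/rowP => i; apply: hT => A B vA wB.
have [u [Au Bu]] := vw _ _ (rV_coord_continuous vA) (rV_coord_continuous wB).
by exists (u 0 i).
Qed.

End row_topology.

Lemma row_map_continuous (n : nat) (S T : topologicalType) (f : 'I_n -> S -> T)
    (v : 'rV[S]_n) : (forall i, {for v 0 i, continuous (f i)}) ->
  {for v, continuous (fun v : 'rV[S]_n => \row_i f i (v 0 i))}.
Proof.
move=> fc; apply: rV_continuous => i.
rewrite (_ : (fun _ => _) = f i \o (fun v : 'rV[S]_n => v 0 i)); last first.
  by apply/funext => w /=; rewrite mxE.
by apply: continuous_comp; [exact: rV_coord_continuous|exact: fc].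
Qed.

(** Bases are indexed families: a countable index type gives second countability, and finite
    functions into it index a base of the row space. *)
Definition base_family (T : topologicalType) (I : Type) (B : I -> set T) : Prop :=
  (forall i, open (B i)) /\
  forall x A, nbhs x A -> exists2 i, B i x & B i `<=` A.

Lemma base_family_second_countable (T : topologicalType) (I : countType)
  (B : I -> set T) : base_family B -> @second_countable T.
Proof.
move=> [oB HB]; exists (range B).
  apply/(sub_countable (B := [set: I])); first exact: card_image_le.
  exact: countableP.
split=> [_ [i _ <-]//|x A /HB[i Bix BiA]].
by exists (B i) => //; split=> //; exists i.
Qed.

Lemma rV_base_family (n : nat) (T : topologicalType) (I : Type)
    (B : I -> set T) : base_family B ->
  base_family (fun f : {ffun 'I_n -> I} =>
    [set v : 'rV[T]_n | forall i, B (f i) (v 0 i)]).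
Proof.
move=> [oB HB]; split=> [f|v A /rV_nbhsP[P vP PA]].
  by apply: (open_box (U := fun i => B (f i))) => i; exact: oB.
have /(_ _)/cid2 H i : exists2 j, B j (v 0 i) & B j `<=` P i by exact: HB.
exists [ffun i => s2val (H i)] => [i|w wB].
  by rewrite ffunE; case: (H i).
by apply: PA => i; move: (wB i); rewrite ffunE; case: (H i) => j /= _; exact.
Qed.

Lemma openI_preimage (S T : topologicalType) (D : set S) (f : S -> T) (U : set T) :
  open D -> (forall x, D x -> {for x, continuous f}) -> open U ->
  open (D `&` f @^-1` U).
Proof.
move=> oD cf oU; rewrite openE => x [Dx Ux]; apply: filterI.
  by apply: open_nbhs_nbhs; split.
by apply: cf => //; apply: open_nbhs_nbhs; split.
Qed.

(** * Countable base and connectedness of C^n *)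

Section cplx_space.
Context {R : realType}.
Local Notation C := (cplx R).

Definition rat_box (q : rat * rat * rat * rat) : set C := let: (a, b, c, d) := q in
  [set z | ratr a < complex.Re z /\ complex.Re z < ratr b /\
           ratr c < complex.Im z /\ complex.Im z < ratr d].

Lemma rat_box_base_family : base_family rat_box.
Proof.
split=> [[[[a b] c] d]|z A /nbhs_cplxP[e e0 eA]].
  have oR (U : set R) : open U -> open ((@complex.Re R : C -> R) @^-1` U).
    by move=> oU; apply: open_comp => // z _; exact: Re_continuous.
  have oI (U : set R) : open U -> open ((@complex.Im R : C -> R) @^-1` U).
    by move=> oU; apply: open_comp => // z _; exact: Im_continuous.
  rewrite (_ : rat_box _ =
    (@complex.Re R : C -> R) @^-1` [set x | ratr a < x] `&`
    ((@complex.Re R : C -> R) @^-1` [set x | x < ratr b] `&`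
    ((@complex.Im R : C -> R) @^-1` [set x | ratr c < x] `&`
     (@complex.Im R : C -> R) @^-1` [set x | x < ratr d]))) //.
  by do !apply: openI; [apply: oR; exact: open_gt|apply: oR; exact: open_lt|
    apply: oI; exact: open_gt|apply: oI; exact: open_lt].
have approx x : exists p : rat * rat,
    [/\ (ratr p.1 : R) < x, x < ratr p.2 & forall y, ratr p.1 < y -> y < ratr p.2 ->
     `|x - y| < e].
  have [p] := @rat_in_itvoo R (x - e) x (ltac:(by rewrite ltrBlDr ltrDl)).
  have [q] := @rat_in_itvoo R x (x + e) (ltac:(by rewrite ltrDl)).
  rewrite !in_itv /= => /andP[q1 q2] /andP[p1 p2]; exists (p, q) => /=; split=> //.
  move=> y py yq; rewrite ltr_norml; apply/andP; split; lra.
have [[a b] /= [a1 a2 ab]] := approx (complex.Re z).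
have [[c d] /= [c1 c2 cd]] := approx (complex.Im z).
exists (a, b, c, d) => //= w [wa [wb [wc wd]]].
by apply: eA; rewrite ?Re_sub ?Im_sub; [exact: ab|exact: cd].
Qed.

Lemma rV_cplx_second_countable (n : nat) : @second_countable 'rV[C]_n.
Proof.
apply: (@base_family_second_countable _ {ffun 'I_n -> rat * rat * rat * rat}).
exact: (@rV_base_family n C _ _ rat_box_base_family).
Qed.

Lemma rline_continuous (n : nat) (z v : 'rV[C]_n) :
  continuous (fun t : R => z + (t%:C%C : C) *: v).
Proof.
move=> t; apply: rV_continuous => i.
rewrite (_ : (fun _ => _) = fun s : R => z 0 i + (s%:C%C : C) * v 0 i); last first.
  by apply/funext => s; rewrite !mxE.
apply: (@cvgD _ C _ (nbhs t)); first exact: cvg_cst.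
by apply: (@cvgMl _ _ (nbhs t) _); exact: real_complex_continuous.
Qed.

Lemma rV_cplx_connected (n : nat) : connected [set: 'rV[C]_n].
Proof.
pose f (v : 'rV[C]_n) (t : R) := 0 + (t%:C%C : C) *: v.
rewrite (_ : setT = \bigcup_(v in [set: 'rV[C]_n]) (f v @` `[0, 1])); last first.
  apply/seteqP; split=> v //= _; exists v => //; exists 1.
    by rewrite /= in_itv /= ler01 lexx.
  by rewrite /f add0r scale1r.
apply: bigcup_connected => [|v _].
  exists 0 => v _; exists 0; first by rewrite /= in_itv /= lexx ler01.
  by rewrite /f scale0r addr0.
apply: connected_continuous_connected; first exact: segment_connected.
by apply: continuous_subspaceT; exact: rline_continuous.
Qed.

End cplx_space.

(** * The projective line *)

Section projective_line.
Context {R : realType}.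
Local Notation C := (cplx R).
Local Notation P1 := (one_point_compactification C).

(** The coordinate at infinity is -1/z rather than 1/z: the transition map is still an involution,
    and its derivative w^-2 carries no sign, so that jacobian determinants are exactly the
    transition functions of O(2, ..., 2). *)
Definition P1_chart (b : bool) (p : P1) : C :=
  if p is Some z then if b then - z^-1 else z else 0.

Definition P1_chart_inv (b : bool) (w : C) : P1 :=
  if b then if w == 0 then None else Some (- w^-1) else Some w.

Definition P1_dom (b : bool) : set P1 := [set~ if b then Some 0 else None].

Lemma P1_chartK b p : P1_dom b p -> P1_chart_inv b (P1_chart b p) = p.
Proof.
case: b p => [] [z|] //=; rewrite /P1_dom /=; first last.
- by move=> /(_ erefl).
- by rewrite eqxx.
rewrite oppr_eq0 invr_eq0 => z0.
by case: eqP => [zE|_]; [rewrite zE in z0|rewrite invrN invrK opprK].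
Qed.

(** The formula also holds at w = 0, outside the overlap, because 0^-1 = 0 and the default value of
    the charts is 0. Transition maps are thus equal as total functions. *)
Lemma P1_chart_trans a b w :
  P1_chart a (P1_chart_inv b w) = if a == b then w else - w^-1.
Proof.
case: a b => [] [] //=; case: eqVneq => [->|_] //=; rewrite ?invr0 ?oppr0 //.
by rewrite invrN invrK opprK.
Qed.

Lemma P1_dom_chart_inv b w : P1_dom b (P1_chart_inv b w).
Proof.
case: b => //; rewrite /P1_dom /=; case: eqP => //= /eqP w0 [/eqP].
by rewrite oppr_eq0 invr_eq0 (negPf w0).
Qed.

Lemma P1_dom_trans a b w :
  P1_dom a (P1_chart_inv b w) <-> a = b \/ w != 0.
Proof.
split; last first.
  move=> [->|w0]; first exact: P1_dom_chart_inv.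
  have [->|ab] := eqVneq a b; first exact: P1_dom_chart_inv.
  case: a b ab => [] [] //= _; rewrite /P1_dom /=; last by rewrite (negPf w0).
  by move=> [w00]; rewrite w00 eqxx in w0.
case: a b => [] [] //=; rewrite /P1_dom /=; [by left|move=> w0; right|
  move=> w0; right|by left].
  by apply/eqP => w00; rewrite w00 in w0.
by apply/eqP => w00; rewrite w00 eqxx in w0.
Qed.

Lemma P1_hausdorff : hausdorff_space P1.
Proof.
apply: one_point_compactification_hausdorff; first exact: cplx_locally_compact.
exact: cplx_hausdorff.
Qed.

Lemma P1_dom_open b : open (P1_dom b).
Proof.
rewrite /P1_dom; apply: closed_openC; apply: accessible_closed_set1.
by apply: hausdorff_accessible; exact: P1_hausdorff.
Qed.

Lemma oppV_continuous (z : C) : z != 0 -> {for z, continuous (fun z : C => - z^-1)}.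
Proof.
move=> z0; apply: (@cvgN _ C C (nbhs z) _).
exact: (@inv_continuous C z z0).
Qed.

Lemma P1_chart_continuous b p : P1_dom b p -> {for p, continuous (P1_chart b)}.
Proof.
case: p => [z|] zD.
  suff H : {for z, continuous (P1_chart b \o Some)} by move=> A /H.
  case: b zD => zD; last exact: cvg_id.
  by apply: oppV_continuous; apply/eqP => z0; apply: zD; rewrite z0.
case: b zD => [_|zD]; last by case: (zD erefl).
move=> A /nbhs_ballP[_/posC_ex[e e0 ->] eA].
(* Neighbourhoods of infinity are complements of compact sets. Outside this box |z| > 1/e, hence
   |-1/z| < e. *)
pose K := [set z : C | `|complex.Re z| <= e^-1 /\ `|complex.Im z| <= e^-1].
exists K; first by split; [exact: compact_box|exact: closed_box].
move=> _ [[z Kz <-]|->] /=; last by apply: eA; apply: ballxx; rewrite ltcR.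
apply: eA; rewrite -ball_normE /ball_ /= sub0r opprK normfV.
have ez : (e^-1)%:C%C < `|z|.
  case: (ltP e^-1 `|complex.Re z|) => [zR|zR].
    by apply: lt_le_trans (norm_Re_le z); rewrite ltcR.
  case: (ltP e^-1 `|complex.Im z|) => [zI|zI].
    by apply: lt_le_trans (norm_Im_le z); rewrite ltcR.
  by exfalso; apply: Kz.
rewrite -[e]invrK -[(e^-1^-1)%:C%C]/((real_complex R) _) fmorphV.
by rewrite ltf_pV2 // ?posrE ?(lt_trans _ ez)// ltcR invr_gt0.
Qed.

Lemma P1_chart_inv_continuous b : continuous (P1_chart_inv b).
Proof.
case: b => z; last exact: one_point_compactification_some_continuous.
have [->|z0] := eqVneq z 0; last first.
  have zE : \forall w \near z, (Some (- w^-1) : P1) = P1_chart_inv true w.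
    near=> w; rewrite /P1_chart_inv ifN_eq//.
    by near: w; exact: (@cvgr_neq0 _ C _ (nbhs z) _ id z cvg_id).
  apply: (cvg_trans (near_eq_cvg zE)); rewrite /P1_chart_inv (negPf z0).
  by move=> A /(oppV_continuous z0).
move=> A; rewrite /P1_chart_inv eqxx => -[K [Kc _] KA].
(* The compact set to be avoided is bounded by B, and |-1/w| > B as soon as 0 < |w| < 1/B; the point
   w = 0 is sent to infinity. *)
have [B B0 HB] := compact_bounded_cplx Kc.
apply/nbhs_ballP; exists (B^-1)%:C%C => [|w]; first by rewrite /= ltcR invr_gt0.
rewrite -ball_normE /ball_ /= sub0r normrN => wB.
change (A (P1_chart_inv true w)); rewrite /P1_chart_inv.
case: (eqVneq w 0) => [_|w0]; apply: KA; [by right|left].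
exists (- w^-1) => //= /HB; rewrite normrN normfV => wB'.
suff : `|w|^-1 < `|w|^-1 by rewrite ltxx.
apply: le_lt_trans wB' _.
rewrite -[B]invrK -[(B^-1^-1)%:C%C]/((real_complex R) _) fmorphV.
by rewrite ltf_pV2 // posrE ?normr_gt0// ltcR invr_gt0.
Unshelve. all: by end_near. Qed.

End projective_line.

(** * Complex differentials and jacobians *)

Section row_differential.
Context {K : numFieldType} {V : normedModType K} {n : nat}.
Implicit Types (f : V -> 'rV[K]_n) (x v : V).

Lemma differentiable_rV f x : (forall i, differentiable (fun y => f y 0 i) x) ->
  differentiable f x.
Proof.
move=> fd; rewrite (_ : f = \sum_(i < n) (fun y => f y 0 i *: delta_mx 0 i)).
  by apply: differentiable_sum => i; exact: differentiableZl.
apply/funext => y; rewrite fct_sumE [LHS]row_sum_delta.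
by [].
Qed.

Lemma diff_coord (M : 'rV[K]_n) i (v : 'rV[K]_n) :
  'd (fun N : 'rV[K]_n => N 0 i) M v = v 0 i.
Proof.
have @g : {linear 'rV[K]_n -> K}.
  by exists (fun N : 'rV[K]_n => N 0 i); do 2![eexists]; do ?[constructor];
     rewrite ?mxE// => ? *; rewrite ?mxE//; move=> ?; rewrite !mxE.
rewrite (_ : (fun _ => _) = g) // diff_lin //.
exact: coord_continuous.
Qed.

Lemma diff_rV_coord f x v i : differentiable f x ->
  'd (fun y => f y 0 i) x v = ('d f x v) 0 i.
Proof.
move=> fd.
have E := diff_comp fd (@differentiable_coord K _ _ (f x) 0 i).
by rewrite -[RHS](diff_coord (f x)) -[RHS]/(('d _ (f x) \o 'd f x) v) -E.
Qed.

End row_differential.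

Section jacobian_diagonal.
Context {K : numFieldType} {n : nat}.
Implicit Types (z : 'rV[K]_n).

Lemma jacobianE (f : 'rV[K]_n -> 'rV[K]_n) z i j : differentiable f z ->
  jacobian f z i j = 'd (fun y => f y 0 j) z (delta_mx 0 i).
Proof. by move=> fd; rewrite /jacobian mxE diff_rV_coord. Qed.

Lemma differentiable_coordwise (h : 'I_n -> K -> K) z :
  (forall i, differentiable (h i) (z 0 i)) ->
  differentiable (fun y : 'rV[K]_n => \row_i h i (y 0 i)) z.
Proof.
move=> hd; apply: differentiable_rV => i.
rewrite (_ : (fun _ => _) = h i \o (fun y : 'rV[K]_n => y 0 i)); last first.
  by apply/funext => y /=; rewrite mxE.
by apply: differentiable_comp; [exact: differentiable_coord|exact: hd].
Qed.

Lemma jacobian_coordwise (h : 'I_n -> K -> K) z :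
  (forall i, differentiable (h i) (z 0 i)) ->
  jacobian (fun y : 'rV[K]_n => \row_i h i (y 0 i)) z =
  diag_mx (\row_i 'd (h i) (z 0 i) 1).
Proof.
move=> hd; apply/matrixP => i j.
rewrite jacobianE; last exact: differentiable_coordwise.
rewrite (_ : (fun _ => _) = h j \o (fun y : 'rV[K]_n => y 0 j)); last first.
  by apply/funext => y /=; rewrite mxE.
have E := diff_comp (@differentiable_coord K _ _ z 0 j) (hd j).
rewrite E /= diff_coord !mxE /= eq_sym.
case: eqVneq => [->|_]; rewrite ?mulr1n ?mulr0n //.
by rewrite linear0.
Qed.

End jacobian_diagonal.

Section opp_inverse.
Context {K : numFieldType}.

Lemma differentiable_oppV (w : K) : w != 0 -> differentiable (fun w : K => - w^-1) w.
Proof. by move=> w0; apply: differentiableN; exact: differentiable_Rinv. Qed.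

Lemma diff_oppV (w : K) : w != 0 -> 'd (fun w : K => - w^-1) w 1 = w ^- 2.
Proof.
move=> w0; rewrite (_ : (fun _ => _) = - (GRing.inv : K -> K)) //.
rewrite diffN; last exact: differentiable_Rinv.
by rewrite fctE diff_Rinv// /GRing.scale /= mulr1 opprK.
Qed.

End opp_inverse.

(** * The manifold (P^1)^n *)

Section projective_line_topology.
Context {R : realType}.
Local Notation C := (cplx R).
Local Notation P1 := (one_point_compactification C).

Lemma P1_dense (p : P1) (A : set P1) : nbhs p A -> exists z, A (Some z).
Proof.
case: p => [z|] pA; first by exists z; exact: nbhs_singleton pA.
case: pA => K [Kc _] KA; have [B B0 HB] := compact_bounded_cplx Kc.
exists (B + 1)%:C%C; apply: KA; left; exists (B + 1)%:C%C => // /HB /(le_trans (norm_Re_le _)).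
by rewrite lecR => /(le_trans (ler_norm _)); rewrite gerDl ler10.
Qed.

Lemma P1_base_family : base_family (fun bq : bool * (rat * rat * rat * rat) =>
  P1_chart_inv bq.1 @` rat_box bq.2 : set P1).
Proof.
have [oB HB] := @rat_box_base_family R.
split=> [[b q]|p A pA] /=.
  rewrite (_ : _ @` _ = @P1_dom R b `&` P1_chart b @^-1` (rat_box q)).
    by apply: openI_preimage => //; [exact: P1_dom_open|exact: P1_chart_continuous].
  apply/seteqP; split=> [_ [z zq <-]|p [pb pq]].
    by split; [exact: P1_dom_chart_inv|rewrite /= P1_chart_trans eqxx].
  by exists (P1_chart b p) => //; exact: P1_chartK.
have [b pb] : exists b, P1_dom b p.
  by case: p {pA} => [z|]; [exists false|exists true].
have [q qp qA] : exists2 q, rat_box q (P1_chart b p) &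
    rat_box q `<=` @P1_chart_inv R b @^-1` A.
  by apply: HB; apply: P1_chart_inv_continuous; rewrite P1_chartK.
exists (b, q) => /=; first by exists (P1_chart b p) => //; exact: P1_chartK.
by move=> _ [z zq <-]; exact: qA.
Qed.

End projective_line_topology.

Section projective_lines.
Context {R : realType} (n : nat).
Local Notation C := (cplx R).
Local Notation P1 := (one_point_compactification C).
Local Notation P1n := 'rV[P1]_n.
Implicit Types (a b : 'I_n -> bool) (p : P1n) (z : 'rV[C]_n).

Definition P1_trans (ab : bool) : C -> C := if ab then id else fun w => - w^-1.

(** The 2^n product charts are indexed by the set of coordinates that are read near infinity. *)
Definition P1n_dom a : set P1n := [set p | forall i, P1_dom (a i) (p 0 i)].

Definition P1n_chart a p : 'rV[C]_n := \row_i P1_chart (a i) (p 0 i).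

Definition P1n_chart_inv a z : P1n := \row_i P1_chart_inv (a i) (z 0 i).

Definition P1n_chart_at p : 'I_n -> bool := fun i => p 0 i == None.

Lemma P1n_dom_chart_at p : P1n_dom (P1n_chart_at p) p.
Proof.
by move=> i; rewrite /P1n_chart_at /P1_dom /=; case: eqP => [->|].
Qed.

Lemma P1n_dom_open a : open (P1n_dom a).
Proof. by apply: (open_box (U := fun i => P1_dom (a i))) => i; exact: P1_dom_open. Qed.

Lemma P1n_chartK a p : P1n_dom a p -> P1n_chart_inv a (P1n_chart a p) = p.
Proof. by move=> pa; apply/rowP => i; rewrite !mxE P1_chartK. Qed.

Lemma P1n_dom_chart_inv a z : P1n_dom a (P1n_chart_inv a z).
Proof. by move=> i; rewrite mxE; exact: P1_dom_chart_inv. Qed.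

Lemma P1n_chart_invK a z : P1n_chart a (P1n_chart_inv a z) = z.
Proof. by apply/rowP => i; rewrite !mxE P1_chart_trans eqxx. Qed.

Lemma P1n_chart_image a : P1n_chart a @` P1n_dom a = setT.
Proof.
apply/seteqP; split=> // z _.
by exists (P1n_chart_inv a z); [exact: P1n_dom_chart_inv|exact: P1n_chart_invK].
Qed.

Lemma P1n_chart_continuous a p : P1n_dom a p -> {for p, continuous (P1n_chart a)}.
Proof.
move=> pa; apply: (@row_map_continuous n P1 C (fun i => P1_chart (a i))) => i.
exact: P1_chart_continuous.
Qed.

Lemma P1n_chart_inv_continuous a : continuous (P1n_chart_inv a).
Proof.
move=> z; apply: (@row_map_continuous n C P1 (fun i => P1_chart_inv (a i))) => i.
exact: P1_chart_inv_continuous.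
Qed.

Lemma P1n_chart_trans a b : P1n_chart a \o P1n_chart_inv b =
  fun z => \row_i P1_trans (a i == b i) (z 0 i).
Proof.
apply/funext => z /=; apply/rowP => i; rewrite !mxE P1_chart_trans /P1_trans.
by case: ifP.
Qed.

Lemma P1n_dom_chart_neq0 a b p i : P1n_dom a p -> P1n_dom b p -> a i != b i ->
  P1n_chart b p 0 i != 0.
Proof.
move=> pa pb ab; have := pa i; rewrite -{1}(P1n_chartK pb) mxE => /P1_dom_trans[abE|//].
by rewrite abE eqxx in ab.
Qed.

Lemma P1n_trans_differentiable a b p i : P1n_dom a p -> P1n_dom b p ->
  differentiable (P1_trans (a i == b i)) (P1n_chart b p 0 i).
Proof.
move=> pa pb; rewrite /P1_trans; case: ifPn => [_|ab]; first exact: ex_diff.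
by apply: differentiable_oppV; exact: P1n_dom_chart_neq0.
Qed.

Lemma P1n_chart_holomorphic a b p : P1n_dom a p -> P1n_dom b p ->
  differentiable (P1n_chart a \o P1n_chart_inv b) (P1n_chart b p).
Proof.
move=> pa pb; rewrite P1n_chart_trans.
apply: (differentiable_coordwise (h := fun i => P1_trans (a i == b i))) => i.
exact: P1n_trans_differentiable.
Qed.

Lemma P1n_hausdorff : hausdorff_space P1n.
Proof. by apply: rV_hausdorff; exact: P1_hausdorff. Qed.

Lemma P1n_second_countable : @second_countable P1n.
Proof.
apply: (@base_family_second_countable _
  {ffun 'I_n -> bool * (rat * rat * rat * rat)}).
exact: (@rV_base_family n P1 _ _ P1_base_family).
Qed.

Lemma P1n_compact : compact [set: P1n].
Proof.
have := @rV_compact P1 n (fun=> setT) (fun=> one_point_compactification_compact).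
by congr compact; apply/seteqP; split.
Qed.

Lemma P1n_affine_dense : dense (range (P1n_chart_inv (fun=> false))).
Proof.
move=> U [p Up] oU.
have /rV_nbhsP[P pP PU] : nbhs p U by apply: open_nbhs_nbhs; split.
have H i : exists w : C, P i (Some w) by exact: P1_dense (pP i).
exists (\row_i (Some (projT1 (cid (H i))) : P1)); split.
  by apply: PU => i; rewrite mxE; case: cid.
exists (\row_i projT1 (cid (H i))) => //.
by apply/rowP => i; rewrite !mxE.
Qed.

Lemma P1n_connected : connected [set: P1n].
Proof.
have <- : closure (range (P1n_chart_inv (fun=> false))) = setT.
  apply/seteqP; split=> // p _ A; rewrite nbhsE => -[U [oU Up] UA].
  have [q [Uq fq]] := P1n_affine_dense (ex_intro _ p Up) oU.
  by exists q; split => //; exact: UA.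
apply: connected_closure; apply: connected_continuous_connected.
  exact: rV_cplx_connected.
by apply: continuous_subspaceT; exact: P1n_chart_inv_continuous.
Qed.

Lemma P1n_neq0 : [set: P1n] !=set0.
Proof. by exists (const_mx None). Qed.

Definition P1n_manifold : complexManifold R n.
Proof.
refine (@ComplexManifold R n _ P1n_neq0 P1n_hausdorff P1n_second_countable
  P1n_connected _ P1n_dom P1n_chart P1n_chart_inv P1n_chart_at
  P1n_dom_chart_at P1n_dom_open _ P1n_chartK P1n_chart_continuous
  (fun a z _ => @P1n_chart_inv_continuous a z) P1n_chart_holomorphic).
abstract (by move=> a; rewrite P1n_chart_image; exact: openT).
Defined.

End projective_lines.

Lemma quotient_rule_eq0 (K : fieldType) (f g df dg : K) : g != 0 ->
  f * (- g ^- 2 * dg) + g^-1 * df = 0 -> df * g = f * dg.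
Proof.
move=> g0 H; have : (df * g - f * dg) / g ^+ 2 = 0 by rewrite -[RHS]H; field.
move/eqP; rewrite mulf_eq0 invr_eq0 expf_eq0 (negPf g0) andbF orbF subr_eq0.
by move/eqP.
Qed.

(** * Immersions in homogeneous coordinates *)

Section quotient_jacobian.
Context {K : numFieldType} {n : nat}.
Implicit Types (F G : 'rV[K]_n -> K) (z v : 'rV[K]_n).

Lemma diff_quotient_eq0 F G z v : differentiable F z -> differentiable G z ->
  G z != 0 -> 'd (fun y => F y / G y) z v = 0 ->
  'd F z v * G z = F z * 'd G z v.
Proof.
move=> Fd Gd G0; rewrite (_ : (fun _ => _) = F * (fun y => (G y)^-1)) //.
rewrite (diffM Fd (differentiableV Gd G0)) /= diffV// => H.
exact: (quotient_rule_eq0 G0 H).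
Qed.

(** A vector v killed by all differentials of F_k / F_k0 satisfies dF_k(v) F_k0 = F_k dF_k0(v). The
    index k with F_k = 1 forces dF_k0(v) = 0, and then every dF_k(v) vanishes. Immersivity for an
    arbitrary denominator is so reduced to the numerators. *)
Lemma row_free_jacobian_quotient (N : nat) (F : 'I_N -> 'rV[K]_n -> K) k0 z :
  (forall k, differentiable (F k) z) -> F k0 z != 0 ->
  (exists k, F k = cst 1) ->
  (forall v, (forall k, 'd (F k) z v = 0) -> v = 0) ->
  row_free (jacobian (fun y => \row_k (F k y / F k0 y)) z).
Proof.
move=> Fd F0 [k1 Fk1] Finj; apply: inj_row_free => v.
rewrite /jacobian mul_rV_lin1 => dv0; apply: Finj.
have Qd k : differentiable (fun z => F k z / F k0 z) z.
  by apply: differentiableM => //; exact: differentiableV.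
pose f y := \row_k (F k y / F k0 y).
have fE k : (fun y => f y 0 k) = (fun y => F k y / F k0 y).
  by apply/funext => y; rewrite mxE.
have fd : differentiable f z by apply: differentiable_rV => k; rewrite fE.
have quot k : 'd (F k) z v * F k0 z = F k z * 'd (F k0) z v.
  apply: diff_quotient_eq0 => //.
  by rewrite -fE diff_rV_coord// dv0 mxE.
have dk0 : 'd (F k0) z v = 0.
  by have := quot k1; rewrite Fk1 diff_cst mul0r /= mul1r.
move=> k; apply: (mulIf F0).
by rewrite quot dk0 mulr0 mul0r.
Qed.

End quotient_jacobian.

(** * Ampleness of the anticanonical bundle of (P^1)^n *)

Section anticanonical_ample.
Context {R : realType} (n : nat).
Local Notation C := (cplx R).
Local Notation P1 := (one_point_compactification C).
Local Notation Xn := (P1n_manifold (R := R) n).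
Implicit Types (a b : 'I_n -> bool) (p : Xn) (z v : 'rV[C]_n)
  (e : {ffun 'I_n -> 'I_3}).

Lemma anticanonical_P1n a b p : P1n_dom a p -> P1n_dom b p ->
  anticanonical Xn a b p =
  \prod_i (if a i == b i then 1 else P1n_chart b p 0 i ^- 2).
Proof.
move=> pa pb; rewrite /anticanonical /= P1n_chart_trans.
rewrite (jacobian_coordwise (h := fun i => P1_trans (a i == b i))); last first.
  by move=> i; exact: P1n_trans_differentiable.
rewrite det_diag; apply: eq_bigr => i _; rewrite mxE /P1_trans.
case: ifPn => [_|ab]; first by rewrite diff_val.
by rewrite diff_oppV//; exact: P1n_dom_chart_neq0 ab.
Qed.

(* The section x^e y^(2-e) of O(2) on P^1, in the coordinates z = x/y (if [b] is
   false) and w = -y/x (if [b] is true). *)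
Definition P1_monomial (k : 'I_3) (b : bool) (w : C) : C :=
  if b then (- w) ^+ (2 - k) else w ^+ k.

Lemma P1_monomial_trans k (b c : bool) (w : C) : b = c \/ w != 0 ->
  P1_monomial k b (P1_trans (b == c) w) =
  (if b == c then 1 else w ^- 2) * P1_monomial k c w.
Proof.
move=> bcw; have [<-|bc] := eqVneq b c; first by rewrite mul1r.
have w0 : w != 0 by case: bcw => // /eqP; rewrite (negPf bc).
rewrite /P1_monomial /P1_trans; case: b c bc {bcw} => [] [] //= _;
  by case: k => -[|[|[|//]]] /= _; rewrite ?subn0 ?subSS ?subn0; field.
Qed.

Definition P1n_monomial e a z : C := \prod_i P1_monomial (e i) (a i) (z 0 i).

Definition P1n_section e a p : C := P1n_monomial e a (P1n_chart a p).

Lemma P1n_section_trans e a b p : P1n_dom a p -> P1n_dom b p ->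
  P1n_section e a p = anticanonical Xn a b p * P1n_section e b p.
Proof.
move=> pa pb; rewrite anticanonical_P1n// -big_split /=; apply: eq_bigr => i _.
rewrite -P1_monomial_trans.
  by rewrite -{1}(P1n_chartK pb) !mxE P1_chart_trans /P1_trans; case: eqVneq.
have [->|ab] := eqVneq (a i) (b i); [by left|right].
exact: P1n_dom_chart_neq0 ab.
Qed.

Lemma P1n_section_chart_inv e a z :
  P1n_section e a (P1n_chart_inv a z) = P1n_monomial e a z.
Proof. by rewrite /P1n_section P1n_chart_invK. Qed.

Lemma P1_monomial_differentiable k (b : bool) (w : C) : differentiable (P1_monomial k b) w.
Proof.
case: b; rewrite /P1_monomial.
  case: (2 - k)%N => [|m]; first exact: differentiable_cst.
  rewrite (_ : (fun _ => _) = (- id) ^+ m.+1 :> (C -> C)) //.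
  by rewrite exprfctE.
case: (k : nat) => [|m]; first exact: differentiable_cst.
rewrite (_ : (fun _ => _) = id ^+ m.+1 :> (C -> C)) //.
by rewrite exprfctE.
Qed.

Lemma P1n_monomial_differentiable e a z : differentiable (P1n_monomial e a) z.
Proof.
pose f i (z : 'rV[C]_n) := P1_monomial (e i) (a i) (z 0 i).
have fd i : differentiable (f i) z.
  apply: (@differentiable_comp _ _ _ _ (fun z : 'rV[C]_n => z 0 i)).
    exact: differentiable_coord.
  exact: P1_monomial_differentiable.
rewrite (_ : P1n_monomial e a = fun z => \prod_(i <- index_enum 'I_n) f i z) //.
elim: (index_enum _) => [|i s IHs].
  by rewrite (_ : (fun _ => _) = cst 1) //; apply/funext => x; rewrite big_nil.
rewrite (_ : (fun _ => _) = f i * (fun z => \prod_(i <- s) f i z)).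
  exact: differentiableM.
by apply/funext => x; rewrite big_cons.
Qed.

(** This section is y^2 in the finite coordinates and x^2 in the infinite ones: it trivializes the
    bundle over the chart [a], where it is identically 1. *)
Definition base_index a : {ffun 'I_n -> 'I_3} :=
  [ffun i => if a i then inord 2 else inord 0].

(** Changing a single exponent of the trivializing section isolates one coordinate: in the chart [a]
    the result depends on coordinate [i0] only. *)
Definition shift_index a (i0 : 'I_n) (k : 'I_3) : {ffun 'I_n -> 'I_3} :=
  [ffun i => if i == i0 then k else base_index a i].

Lemma P1n_monomial_base a z : P1n_monomial (base_index a) a z = 1.
Proof.
apply: big1 => i _; rewrite ffunE /P1_monomial.
by case: (a i); rewrite inordK.
Qed.

Lemma P1n_monomial_shift a b i0 k z : P1n_monomial (shift_index a i0 k) b z =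
  P1_monomial k (b i0) (z 0 i0) *
  \prod_(i | i != i0) P1_monomial (base_index a i) (b i) (z 0 i).
Proof.
rewrite /P1n_monomial (bigD1 i0)//= ffunE eqxx; congr (_ * _).
by apply: eq_bigr => i ii0; rewrite ffunE (negPf ii0).
Qed.

Lemma P1n_monomial_shift_same a i0 k z : P1n_monomial (shift_index a i0 k) a z =
  P1_monomial k (a i0) (z 0 i0).
Proof.
rewrite P1n_monomial_shift big1 ?mulr1// => i _.
by rewrite ffunE /P1_monomial; case: (a i); rewrite inordK.
Qed.

(** The conic [y^2 : xy : x^2] determines [x : y]. The scalar [d] will contain factors from the
    other coordinates, which could vanish a priori; the monomial equal to 1 at [x] excludes d =
    0. *)
Lemma P1_monomial_inj (x y : P1) (d : C) :
  (forall k, P1_monomial k (x == None) (P1_chart (x == None) x) =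
             d * P1_monomial k (y == None) (P1_chart (y == None) y)) -> x = y.
Proof.
rewrite /P1_monomial => H.
have := H (inord 0); have := H (inord 1); have := H (inord 2).
rewrite !inordK//; case: x y {H} => [z|] [w|] //=.
- by rewrite !expr0 !expr1 mulr1 => _ + dE; rewrite -dE mul1r => ->.
- by move=> _ _; rewrite oppr0 subn0 expr0n mulr0 => /eqP; rewrite oner_eq0.
- move=> + _; rewrite oppr0 subn0 subnn !expr0 [in X in _ -> X]expr0n mulr1.
  by move=> + dE; rewrite -dE mul0r => /eqP; rewrite oner_eq0.
Qed.

Lemma anticanonical_P1n_very_ample :
  very_ample (tensor_power (anticanonical Xn) 1).
Proof.
(* Sections are indexed by some ['I_N.+1], so the 3^n multi-exponents are enumerated through the
   predecessor of their number. *)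
have T0 : (0 < #|{ffun 'I_n -> 'I_3}|)%N by rewrite card_ffun !card_ord expn_gt0.
have TE := prednK T0.
pose idx (k : 'I_(#|{ffun 'I_n -> 'I_3}|.-1.+1)) := enum_val (cast_ord TE k).
have idx_onto e : exists k, idx k = e.
  exists (cast_ord (esym TE) (enum_rank e)).
  by rewrite /idx cast_ordKV enum_rankK.
exists _, (fun k => P1n_section (idx k)); split.
- move=> k; split=> [a p pa|a b p pa pb] /=.
    rewrite (_ : _ \o _ = P1n_monomial (idx k) a).
      exact: P1n_monomial_differentiable.
    by apply/funext => z; exact: P1n_section_chart_inv.
  by rewrite /tensor_power expr1; exact: P1n_section_trans.
- move=> p; have [k kE] := idx_onto (base_index (P1n_chart_at p)).
  by exists k; rewrite kE /P1n_section P1n_monomial_base oner_neq0.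
- move=> p q [c c0 H]; apply/rowP => i0.
  (* At q, which may lie in another chart, the other coordinates contribute a factor that does not
     depend on the exponent m at i0; it is absorbed into the scalar. *)
  pose Q := \prod_(i | i != i0) P1_monomial (base_index (P1n_chart_at p) i)
    (P1n_chart_at q i) (P1n_chart (P1n_chart_at q) q 0 i).
  apply: (@P1_monomial_inj _ _ (c * Q)) => m.
  have [k kE] := idx_onto (shift_index (P1n_chart_at p) i0 m).
  have := H k; rewrite kE /P1n_section P1n_monomial_shift_same.
  rewrite P1n_monomial_shift -/Q !mxE => ->.
  by rewrite mulrCA mulrC.
move=> p k0 /=; set a := P1n_chart_at p; set z := P1n_chart a p => k0p.
rewrite (_ : (fun _ => _) =
    fun y => \row_k (P1n_monomial (idx k) a y / P1n_monomial (idx k0) a y)); last first.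
  by apply/funext => y; apply/rowP => k; rewrite !mxE !P1n_section_chart_inv.
apply: (row_free_jacobian_quotient (F := fun k => P1n_monomial (idx k) a)) => //.
- by move=> k; exact: P1n_monomial_differentiable.
- have [k kE] := idx_onto (base_index a); exists k; rewrite kE.
  by apply/funext => y; exact: P1n_monomial_base.
move=> v dv0; apply/rowP => i; rewrite mxE.
(* With exponent 1 at i, the section is the i-th coordinate up to sign, so its differential at v
   detects v_i. *)
have [k kE] := idx_onto (shift_index a i (inord 1)); have := dv0 k; rewrite kE.
have -> : P1n_monomial (shift_index a i (inord 1)) a =
    fun y => if a i then - y 0 i else y 0 i.
  apply/funext => y; rewrite P1n_monomial_shift_same /P1_monomial inordK//.
case: (a i); last by rewrite diff_coord.
rewrite (_ : (fun _ => _) = - (fun y : 'rV[C]_n => y 0 i)) //.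
rewrite diffN; last exact: differentiable_coord.
by move=> /eqP; rewrite fctE oppr_eq0 diff_coord => /eqP.
Qed.

Lemma anticanonical_P1n_ample : ample (anticanonical Xn).
Proof. by exists 1%N => //; exact: anticanonical_P1n_very_ample. Qed.

End anticanonical_ample.

(** * Affine space and its compactification *)

Section affine_space.
Context {R : realType} (n : nat).
Local Notation C := (cplx R).

Definition affine_manifold : complexManifold R n.
Proof.
refine (@ComplexManifold R n 'rV[C]_n (ex_intro _ 0 I) _
  (@rV_cplx_second_countable R n) (@rV_cplx_connected R n) unit
  (fun=> setT) (fun=> id) (fun=> id) (fun=> tt) _ _ _ _ _ _ _).
- abstract (by apply: rV_hausdorff; exact: cplx_hausdorff).
- abstract (by []).
- abstract (by move=> _; exact: openT).
- abstract (by move=> _; rewrite image_id; exact: openT).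
- abstract (by []).
- abstract (by move=> _ p _; exact: cvg_id).
- abstract (by move=> _ z _; exact: cvg_id).
- abstract (by move=> _ _ p _ _; exact: ex_diff).
Defined.

(** In coordinates, the embedding and its inverse are transition maps between the all-finite chart
    of (P^1)^n and the other charts, so their holomorphy is already known. *)
Lemma affine_compactification :
  compactifies affine_manifold (P1n_manifold n).
Proof.
split; first exact: P1n_compact.
pose a0 : 'I_n -> bool := fun=> false.
have rangeE : range (P1n_chart_inv (R := R) a0) = P1n_dom a0.
  apply/seteqP; split=> [_ [z _ <-]|p pa]; first exact: P1n_dom_chart_inv.
  by exists (P1n_chart a0 p) => //; exact: P1n_chartK.
exists (P1n_chart_inv a0), (P1n_chart a0); split.
- by split; [rewrite rangeE; exact: P1n_dom_open|exact: P1n_affine_dense].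
- exact: P1n_chart_invK.
- move=> z; split; first exact: P1n_chart_inv_continuous.
  move=> [] b _ /= zb; rewrite -[X in differentiable _ X](P1n_chart_invK a0).
  by apply: P1n_chart_holomorphic => //; exact: P1n_dom_chart_inv.
move=> p; rewrite rangeE => pa; split; first exact: P1n_chart_continuous.
by move=> b [] /= pb _; exact: P1n_chart_holomorphic.
Qed.

End affine_space.

(** * The cigar metric and its curvature *)

Section complex_curves.
Context {R : realType}.
Local Notation C := (cplx R).
Implicit Types (c : R -> C) (t : R) (d : C).

(** Existence and value of the derivative are kept together, so that the rules of calculus can be
    chained. *)
Definition is_cderive t c d : Prop :=
  is_derive t 1 (fun s => complex.Re (c s)) (complex.Re d) /\
  is_derive t 1 (fun s => complex.Im (c s)) (complex.Im d).

Lemma is_cderive_cderivable t c d : is_cderive t c d -> cderivable1 c t.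
Proof. by move=> [Re_d Im_d]; split; exact: ex_derive. Qed.

Lemma is_cderive_val t c d : is_cderive t c d -> cderive1 c t = d.
Proof.
by move=> [Re_d Im_d]; rewrite /cderive1 !derive1E !derive_val; case: d {Re_d Im_d}.
Qed.

Lemma cderivable1P t c : cderivable1 c t -> is_cderive t c (cderive1 c t).
Proof.
move=> [/derivableP cR /derivableP cI]; split.
  by apply: (is_derive_eq cR); rewrite /cderive1 /= derive1E.
by apply: (is_derive_eq cI); rewrite /cderive1 /= derive1E.
Qed.

Lemma is_cderive_cst t d : is_cderive t (fun=> d) 0.
Proof. by split; exact: is_derive_cst. Qed.

Lemma is_cderiveD t c1 c2 d1 d2 : is_cderive t c1 d1 -> is_cderive t c2 d2 ->
  is_cderive t (fun s => c1 s + c2 s) (d1 + d2).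
Proof.
move=> [R1 I1] [R2 I2]; split.
  rewrite Re_add; under eq_fun do rewrite Re_add; exact: is_deriveD.
rewrite Im_add; under eq_fun do rewrite Im_add; exact: is_deriveD.
Qed.

Lemma is_cderiveM t c1 c2 d1 d2 : is_cderive t c1 d1 -> is_cderive t c2 d2 ->
  is_cderive t (fun s => c1 s * c2 s) (d1 * c2 t + c1 t * d2).
Proof.
move=> [R1 I1] [R2 I2]; split.
  under eq_fun do rewrite Re_mul.
  apply: (is_derive_eq (is_deriveB (is_deriveM R1 R2) (is_deriveM I1 I2))).
  by rewrite Re_add !Re_mul /GRing.scale /=; ring.
under eq_fun do rewrite Im_mul.
apply: (is_derive_eq (is_deriveD (is_deriveM R1 I2) (is_deriveM I1 R2))).
by rewrite Im_add !Im_mul /GRing.scale /=; ring.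
Qed.

Lemma is_cderive_conj t c d : is_cderive t c d ->
  is_cderive t (fun s => (c s)^* ) d^*.
Proof.
move=> [cR cI]; split.
  by rewrite cRe_conj; under eq_fun do rewrite cRe_conj.
rewrite cIm_conj; under eq_fun do rewrite cIm_conj; exact: is_deriveN.
Qed.

Lemma is_cderive_line t (z v : C) : is_cderive t (fun s => z + (s%:C%C : C) * v) v.
Proof.
have line (x y : R) : is_derive t 1 (fun s => x + s * y) y.
  apply: (is_derive_eq (is_deriveD (is_derive_cst x t 1)
    (is_deriveM (is_derive_id t 1) (is_derive_cst y t 1)))).
  by rewrite /GRing.scale /=; ring.
split.
  rewrite (_ : (fun _ => _) = fun s => complex.Re z + s * complex.Re v)//.
  by apply/funext => s; rewrite Re_add Re_mul /= mul0r subr0.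
rewrite (_ : (fun _ => _) = fun s => complex.Im z + s * complex.Im v)//.
by apply/funext => s; rewrite Im_add Im_mul /= mul0r addr0.
Qed.

End complex_curves.

Section cigar_weight.
Context {R : realType}.
Local Notation C := (cplx R).

(* [b] switches between the cigar metric |dz|^2 / (1 + |z|^2) and the flat
   metric |dz|^2 on the complex plane. *)
Definition cigar (b : bool) (z : C) : R :=
  (1 + b%:R * (complex.Re z ^+ 2 + complex.Im z ^+ 2))^-1.

Lemma cigar_denom_gt0 b (z : C) :
  0 < 1 + b%:R * (complex.Re z ^+ 2 + complex.Im z ^+ 2).
Proof. by rewrite ltr_wpDr// mulr_ge0// addr_ge0// sqr_ge0. Qed.

Lemma cigar_gt0 b z : 0 < cigar b z.
Proof. by rewrite invr_gt0 cigar_denom_gt0. Qed.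

Lemma cigarV b (z : C) : ((cigar b z)%:C%C)^-1 = 1 + b%:R * (z * z^* ) :> C.
Proof.
rewrite -[_%:C%C]/((real_complex R) _) -fmorphV invrK.
case: z => x y /=; apply/eqP; rewrite eq_complex /=; apply/andP; split; apply/eqP.
  by case: b; rewrite ?Re_add; simpc; rewrite /=; ring.
by case: b; simpc; rewrite /=; ring.
Qed.

Lemma cigar_real_continuous b : continuous (cigar b).
Proof.
move=> z; apply: (@cvgV _ _ (nbhs z) _); first by rewrite gt_eqF// cigar_denom_gt0.
apply: (@cvgD _ R^o _ (nbhs z) _); first exact: cvg_cst.
apply: (@cvgMr _ _ (nbhs z) _).
by apply: (@cvgD _ R^o _ (nbhs z) _); apply: (@cvgM _ _ (nbhs z) _);
  solve [exact: Re_continuous|exact: Im_continuous].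
Qed.

Lemma cigar_continuous b : continuous (fun z : C => (cigar b z)%:C%C : C).
Proof.
move=> z; apply: (@continuous_comp C R C); last exact: real_complex_continuous.
exact: cigar_real_continuous.
Qed.

Lemma is_derive_cigar_denom b t (c : R -> C) d : is_cderive t c d ->
  is_derive t 1
    (fun s => 1 + b%:R * (complex.Re (c s) ^+ 2 + complex.Im (c s) ^+ 2))
    (b%:R * (2 * (complex.Re (c t) * complex.Re d + complex.Im (c t) * complex.Im d))).
Proof.
move=> [cR cI]; under eq_fun do rewrite !expr2.
apply: (is_derive_eq (is_deriveD (is_derive_cst (1 : R) t 1)
  (is_deriveM (is_derive_cst (b%:R : R) t 1)
    (is_deriveD (is_deriveM cR cR) (is_deriveM cI cI))))).
by rewrite /GRing.scale /=; ring.
Qed.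

Lemma is_derive_cigar b t (c : R -> C) d : is_cderive t c d ->
  is_derive t 1 (fun s => cigar b (c s))
    (- (b%:R * cigar b (c t) ^+ 2 *
      (2 * (complex.Re (c t) * complex.Re d + complex.Im (c t) * complex.Im d)))).
Proof.
move=> /(is_derive_cigar_denom b) cd.
have cd0 := lt0r_neq0 (cigar_denom_gt0 b (c t)).
pose f s := 1 + b%:R * (complex.Re (c s) ^+ 2 + complex.Im (c s) ^+ 2).
apply: (is_derive_eq (@is_deriveV _ f t _ 1 cd0 cd)).
by rewrite /GRing.scale /= /cigar exprVn; ring.
Qed.

Lemma is_cderive_cigar b t (c : R -> C) d : is_cderive t c d ->
  is_cderive t (fun s => (cigar b (c s))%:C%C)
    (- (b%:R * (cigar b (c t))%:C%C ^+ 2 * (d * (c t)^* + d^* * c t))).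
Proof.
move=> cd; set w := - _.
have -> : w = (- (b%:R * cigar b (c t) ^+ 2 *
    (2 * (complex.Re (c t) * complex.Re d + complex.Im (c t) * complex.Im d))))%:C%C.
  rewrite /w; case: (c t) d {w cd} => [x y] [x' y']; apply/eqP.
  rewrite eq_complex /=; case: b => /=; simpc => //=.
  by apply/andP; split; apply/eqP; ring.
by split; [exact: is_derive_cigar|exact: is_derive_cst].
Qed.

End cigar_weight.

(** * Symbolic real and Wirtinger derivatives *)

Section cigar_expressions.
Context {R : realType} {n : nat} (b : 'I_n -> bool).
Local Notation C := (cplx R).
Implicit Types (z v : 'rV[C]_n).

(* This class of functions is closed under differentiation, so that its members
   are smooth and their derivatives are computed symbolically. *)
Inductive expr :=
  | Cst of C | Var of 'I_n | VarC of 'I_n | Cig of 'I_n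
  | Add of expr & expr | Mul of expr & expr.

Fixpoint expr_eval (e : expr) z : C := match e with
  | Cst c => c | Var i => z 0 i | VarC i => (z 0 i)^*
  | Cig i => (cigar (b i) (z 0 i))%:C%C
  | Add e1 e2 => expr_eval e1 z + expr_eval e2 z
  | Mul e1 e2 => expr_eval e1 z * expr_eval e2 z
  end.

(* Derivative in a direction in which z_i and its conjugate have derivatives
   [u i] and [u' i], so that Wirtinger derivatives are also covered. *)
Fixpoint expr_deriv (u u' : 'I_n -> C) (e : expr) : expr := match e with
  | Cst _ => Cst 0 | Var i => Cst (u i) | VarC i => Cst (u' i)
  | Cig i => Mul (Cst (- (b i)%:R)) (Mul (Mul (Cig i) (Cig i))
      (Add (Mul (Cst (u i)) (VarC i)) (Mul (Cst (u' i)) (Var i))))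
  | Add e1 e2 => Add (expr_deriv u u' e1) (expr_deriv u u' e2)
  | Mul e1 e2 => Add (Mul (expr_deriv u u' e1) e2) (Mul e1 (expr_deriv u u' e2))
  end.

Lemma expr_eval_continuous e : continuous (expr_eval e).
Proof.
elim: e => [c|i|i|i|e1 IH1 e2 IH2|e1 IH1 e2 IH2] z /=.
- exact: cst_continuous.
- exact: coord_continuous.
- apply: (@continuous_comp 'rV[C]_n C C (fun z : 'rV[C]_n => z 0 i)).
    exact: coord_continuous.
  exact: conj_continuous.
- apply: (@continuous_comp 'rV[C]_n C C (fun z : 'rV[C]_n => z 0 i)
    (fun w => (cigar (b i) w)%:C%C)); first exact: coord_continuous.
  exact: cigar_continuous.
- by apply: (@cvgD _ C _ (nbhs z) _); [exact: IH1|exact: IH2].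
- by apply: (@cvgM _ _ (nbhs z) _); [exact: IH1|exact: IH2].
Qed.

Lemma is_cderive_eval e z v : is_cderive 0 (rline (expr_eval e) z v)
  (expr_eval (expr_deriv (fun i => v 0 i) (fun i => (v 0 i)^*) e) z).
Proof.
have line i : is_cderive 0 (fun t => (z + (t%:C%C : C) *: v) 0 i) (v 0 i).
  rewrite (_ : (fun _ => _) = fun t => z 0 i + (t%:C%C : C) * v 0 i).
    exact: is_cderive_line.
  by apply/funext => t; rewrite !mxE.
have z0 : z + ((0 : R)%:C%C : C) *: v = z by rewrite scale0r addr0.
have rline0 f : rline f z v 0 = f z by rewrite /rline z0.
elim: e => [c|i|i|i|e1 IH1 e2 IH2|e1 IH1 e2 IH2] /=.
- exact: is_cderive_cst.
- exact: line.
- exact: is_cderive_conj (line i).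
- rewrite (_ : _ * _ = - ((b i)%:R * (cigar (b i) ((z + (0%:C%C : C) *: v) 0 i))%:C%C ^+ 2
    * (v 0 i * ((z + (0%:C%C : C) *: v) 0 i)^* + (v 0 i)^* * (z + (0%:C%C : C) *: v) 0 i))).
    exact: is_cderive_cigar (line i).
  by rewrite z0; ring.
- exact: is_cderiveD IH1 IH2.
- by have := is_cderiveM IH1 IH2; rewrite !rline0.
Qed.

Lemma rderive_eval e v : rderive v (expr_eval e) =
  expr_eval (expr_deriv (fun i => v 0 i) (fun i => (v 0 i)^*) e).
Proof. by apply/funext => z; exact: is_cderive_val (is_cderive_eval e z v). Qed.

Lemma expr_eval_smooth e (U : set 'rV[C]_n) : smooth U (expr_eval e).
Proof.
move=> k; elim: k e => [|k IHk] e /=; split=> //; try by move=> z _; exact: expr_eval_continuous.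
move=> v; split=> [z _|]; first exact: is_cderive_cderivable (is_cderive_eval e z v).
by rewrite rderive_eval; exact: IHk.
Qed.

(** The derivative is the sum of a part linear in the variation of z and a part linear in that of
    its conjugate. Scalars (1, 1) give the direction e_k and (i, -i) the direction i e_k; the
    combinations in [dz] and [dzbar] then each select one part. *)
Lemma expr_deriv_split (a a' : C) (u u' : 'I_n -> C) e z :
  expr_eval (expr_deriv (fun i => a * u i) (fun i => a' * u' i) e) z =
  a * expr_eval (expr_deriv u (fun=> 0) e) z + a' * expr_eval (expr_deriv (fun=> 0) u' e) z.
Proof.
elim: e => [c|i|i|i|e1 IH1 e2 IH2|e1 IH1 e2 IH2] /=; rewrite ?IH1 ?IH2; ring.
Qed.

Definition kron (k i : 'I_n) : C := (i == k)%:R.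

Let deriv_delta k e z : expr_eval (expr_deriv
    (fun i => (delta_mx 0 k : 'rV[C]_n) 0 i)
    (fun i => ((delta_mx 0 k : 'rV[C]_n) 0 i)^*) e) z =
  expr_eval (expr_deriv (kron k) (fun=> 0) e) z + expr_eval (expr_deriv (fun=> 0) (kron k) e) z.
Proof.
rewrite -[X in X + _]mul1r -[X in _ + X]mul1r -expr_deriv_split.
congr (expr_eval (expr_deriv _ _ e) z); apply/funext => i; rewrite mxE eqxx mul1r //=.
by rewrite /kron; case: eqP => _; rewrite ?conjC1 ?conjC0.
Qed.

Let deriv_imu_delta k e z : expr_eval (expr_deriv
    (fun i => (imu R *: delta_mx 0 k : 'rV[C]_n) 0 i)
    (fun i => ((imu R *: delta_mx 0 k : 'rV[C]_n) 0 i)^*) e) z =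
  imu R * expr_eval (expr_deriv (kron k) (fun=> 0) e) z
  - imu R * expr_eval (expr_deriv (fun=> 0) (kron k) e) z.
Proof.
rewrite -mulNr -expr_deriv_split.
congr (expr_eval (expr_deriv _ _ e) z); apply/funext => i; rewrite !mxE eqxx //=.
rewrite rmorphM /=; congr (_ * _); last by rewrite /kron conjC_nat.
by apply/eqP; rewrite eq_complex /= oppr0 eqxx eqxx.
Qed.

Lemma imuM : imu R * imu R = -1.
Proof. exact: sqr_i. Qed.

Lemma dz_eval k e : dz k (expr_eval e) = expr_eval (expr_deriv (kron k) (fun=> 0) e).
Proof.
apply/funext => z; rewrite /dz !rderive_eval deriv_delta deriv_imu_delta.
by rewrite mulrBr !mulrA imuM; field.
Qed.

Lemma dzbar_eval k e : dzbar k (expr_eval e) = expr_eval (expr_deriv (fun=> 0) (kron k) e).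
Proof.
apply/funext => z; rewrite /dzbar !rderive_eval deriv_delta deriv_imu_delta.
by rewrite mulrBr !mulrA imuM; field.
Qed.

End cigar_expressions.

Lemma invmx_diag (K : fieldType) (n : nat) (d : 'rV[K]_n) :
  (forall i, d 0 i != 0) -> invmx (diag_mx d) = diag_mx (\row_i (d 0 i)^-1).
Proof.
move=> d0; set B := diag_mx (\row_i _).
have AB : diag_mx d *m B = 1%:M.
  rewrite mulmx_diag; apply/matrixP => i j; rewrite !mxE.
  by rewrite divff.
have [A_unit _] := mulmx1_unit AB.
by rewrite -[LHS]mulmx1 -AB mulKmx.
Qed.

(** With s = |z|^2, the left side is the curvature of the weight q, minus its mixed second
    derivative plus the product of its first derivatives divided by q. The terms collect into beta
    q^3 (1/q - beta s), whose last factor is 1. *)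
Lemma cigar_curvature_identity (K : fieldType) (beta q s : K) : q != 0 ->
  q^-1 = 1 + beta * s ->
  - (- beta * q ^+ 2 + 2 * beta ^+ 2 * q ^+ 3 * s) +
    q^-1 * (beta * q ^+ 2) * (beta * q ^+ 2) * s = beta * q ^+ 3.
Proof.
move=> q0 qV; transitivity (beta * q ^+ 3 * (q^-1 - beta * s)); first by field.
by rewrite qV; ring.
Qed.

(** * Kähler property and curvature of the product metric *)

Section cigar_metric.
Context {R : realType} {n : nat} (b : 'I_n -> bool).
Local Notation C := (cplx R).
Local Notation M := (affine_manifold (R := R) n).
Local Notation q i z := ((cigar (b i) ((z : 'rV[C]_n) 0 i))%:C%C : C).
Local Notation beta i := ((b i)%:R : C).
Implicit Types (z v : 'rV[C]_n) (i j k l : 'I_n).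

Definition cigar_entry i j : @expr R n := if i == j then Cig i else Cst 0.

Definition cigar_mx (_ : unit) z : 'M[C]_n := \matrix_(i, j) expr_eval b (cigar_entry i j) z.

Lemma cigar_mxE u z : cigar_mx u z = diag_mx (\row_i q i z).
Proof.
apply/matrixP => i j; rewrite !mxE /cigar_entry.
by case: eqVneq => [->|_]; rewrite ?mulr1n ?mulr0n.
Qed.

Lemma cigar_mx_entry u i j : (fun z => cigar_mx u z i j) = expr_eval b (cigar_entry i j).
Proof. by apply/funext => z; rewrite mxE. Qed.

Lemma cplx_cigar_gt0 c (w : C) : 0 < (cigar c w)%:C%C :> C.
Proof. by rewrite ltcR cigar_gt0. Qed.

Lemma cplx_cigar_ge0 c (w : C) : 0 <= (cigar c w)%:C%C :> C.
Proof. exact: ltW (cplx_cigar_gt0 c w). Qed.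

Lemma cigar_form u z v :
  \sum_i \sum_j cigar_mx u z i j * v 0 i * (v 0 j)^* = \sum_i q i z * `|v 0 i| ^+ 2.
Proof.
apply: eq_bigr => i _; rewrite (bigD1 i)//= big1 ?addr0 => [|j ji].
  by rewrite cigar_mxE !mxE eqxx mulr1n normCK mulrA.
by rewrite cigar_mxE !mxE eq_sym (negPf ji) mulr0n !mul0r.
Qed.

Lemma cigar_form_gt0 u z v : v != 0 ->
  0 < \sum_i \sum_j cigar_mx u z i j * v 0 i * (v 0 j)^*.
Proof.
move=> v0; rewrite cigar_form.
have [i vi0] : exists i, v 0 i != 0.
  apply/existsP; apply: contraNT v0 => /existsPn v0; apply/eqP/rowP => i.
  by rewrite mxE; apply/eqP; have := v0 i; rewrite negbK.
rewrite (bigD1 i)//= ltr_wpDr//.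
  by apply: sumr_ge0 => j _; rewrite mulr_ge0 ?exprn_ge0// ltW// cplx_cigar_gt0.
by rewrite mulr_gt0 ?exprn_gt0 ?normr_gt0// cplx_cigar_gt0.
Qed.

Lemma cigar_mx_change (a c : chart_index M) (p : M) : dom a p -> dom c p ->
  let J := jacobian (chart a \o chart_inv c) (chart c p) in
  cigar_mx c (chart c p) = J *m cigar_mx a (chart a p) *m (map_mx Num.conj J)^T.
Proof.
move=> _ _ J.
have -> : J = 1%:M.
  by apply/matrixP => i j; rewrite /J /jacobian mxE diff_val /= !mxE eqxx /= eq_sym.
by rewrite map_mx1 trmx1 mulmx1 mul1mx.
Qed.

Definition cigar_metric : hermitianMetric M.
Proof.
refine (@HermitianMetric R n M cigar_mx _ _ _ _).
- abstract (by move=> u i j; rewrite cigar_mx_entry; exact: expr_eval_smooth).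
- abstract (move=> u z i j _; rewrite cigar_mxE !mxE eq_sym;
    case: eqVneq => [->|_]; rewrite ?mulr0n ?conjC0// mulr1n;
    by rewrite (CrealP _)// gtr0_real// cplx_cigar_gt0).
- abstract (by move=> u z v _; exact: cigar_form_gt0).
- abstract exact: cigar_mx_change.
Defined.

Lemma dz_cigar u i j k z : dz k (fun w => cigar_mx u w i j) z =
  if (i == j) && (k == i) then - beta i * q i z ^+ 2 * (z 0 i)^* else 0.
Proof.
rewrite cigar_mx_entry dz_eval /cigar_entry.
case: (i == j) => //=; rewrite /kron (eq_sym i k); case: (k == i) => /=; ring.
Qed.

(** The curvature differentiates this first derivative once more, so it has to be presented as an
    expression again. *)
Let dzbar_cigar_expr i j l : expr :=
  if (i == j) && (l == i) then
    Mul (Cst (- beta i)) (Mul (Mul (Cig i) (Cig i)) (Var i)) else Cst 0.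

Let dzbar_cigarE u i j l : dzbar l (fun w => cigar_mx u w i j) =
  expr_eval b (dzbar_cigar_expr i j l).
Proof.
rewrite cigar_mx_entry dzbar_eval /cigar_entry /dzbar_cigar_expr.
apply/funext => z.
case: (i == j) => //=; rewrite /kron (eq_sym i l); case: (l == i) => /=; ring.
Qed.

Lemma dzbar_cigar u i j l z : dzbar l (fun w => cigar_mx u w i j) z =
  if (i == j) && (l == i) then - beta i * q i z ^+ 2 * z 0 i else 0.
Proof.
by rewrite dzbar_cigarE /dzbar_cigar_expr; case: (_ && _) => //=; ring.
Qed.

Lemma dz_dzbar_cigar u i j k l z :
  dz k (dzbar l (fun w => cigar_mx u w i j)) z =
  if [&& i == j, l == i & k == i] then
    - beta i * q i z ^+ 2 + 2 * beta i ^+ 2 * q i z ^+ 3 * (z 0 i * (z 0 i)^*)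
  else 0.
Proof.
rewrite dzbar_cigarE dz_eval /dzbar_cigar_expr andbA.
case: ((i == j) && (l == i)) => //=; rewrite /kron (eq_sym i k); case: (k == i) => /=; ring.
Qed.

Lemma cigar_kahler : kahler cigar_metric.
Proof.
move=> u z _ i j k /=; rewrite !dz_cigar !dzbar_cigar; split.
  by have [->|ki] := eqVneq k i; rewrite // !andbF.
by rewrite [in LHS]andbC (eq_sym k i) (eq_sym i j).
Qed.

Lemma cigar_curvature u z i j k l :
  curvature cigar_metric u z i j k l =
  if [&& i == j, l == i & k == i] then beta i * q i z ^+ 3 else 0.
Proof.
rewrite /curvature /= dz_dzbar_cigar.
rewrite cigar_mxE invmx_diag; last by move=> m; rewrite mxE gt_eqF ?cplx_cigar_gt0.
(* Only p = q = i survives in the double sum: the derivative of an off-diagonal coefficient is zero,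
   and the inverse matrix is diagonal. *)
rewrite (bigD1 i)//= [X in _ + (_ + X)]big1 ?addr0; last first.
  move=> m mi; apply: big1 => m' _.
  by rewrite dz_cigar eq_sym (negPf mi) /= mulr0 mul0r.
rewrite (bigD1 i)//= [X in _ + (_ + X)]big1 ?addr0; last first.
  by move=> m mi; rewrite !mxE eq_sym (negPf mi) mulr0n !mul0r.
rewrite dz_cigar dzbar_cigar !mxE eqxx mulr1n /=.
have [_|_] := eqVneq k i; last by rewrite !andbF mulr0 mul0r oppr0 addr0.
have [_|_] := eqVneq i j; last by rewrite mulr0 oppr0 addr0.
have [_|_] := eqVneq l i; last by rewrite /= mulr0 oppr0 addr0.
rewrite /= -(cigar_curvature_identity (s := z 0 i * (z 0 i)^*) _ (cigarV _ _)).
  by ring.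
by rewrite gt_eqF ?cplx_cigar_gt0.
Qed.

Lemma quartic_sum_diag (f : 'I_n -> 'I_n -> 'I_n -> 'I_n -> C) v :
  (forall i j k l, ~~ [&& i == j, l == i & k == i] -> f i j k l = 0) ->
  \sum_i \sum_j \sum_k \sum_l
    f i j k l * v 0 i * (v 0 j)^* * v 0 k * (v 0 l)^* =
  \sum_i f i i i i * `|v 0 i| ^+ 4.
Proof.
move=> f0; apply: eq_bigr => i _.
rewrite (bigD1 i)//= [X in _ + X]big1 ?addr0; last first.
  move=> j ji; apply: big1 => k _; apply: big1 => l _.
  by rewrite f0 ?mul0r// eq_sym (negPf ji).
rewrite (bigD1 i)//= [X in _ + X]big1 ?addr0; last first.
  by move=> k ki; apply: big1 => l _; rewrite f0 ?mul0r// (negPf ki) !andbF.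
rewrite (bigD1 i)//= [X in _ + X]big1 ?addr0; last first.
  by move=> l li; rewrite f0 ?mul0r// (negPf li) andbF.
by rewrite -[4%N]/(2 * 2)%N exprM normCK; ring.
Qed.

Lemma cigar_hsc p v : hsc cigar_metric p v =
  (\sum_i beta i * q i p ^+ 3 * `|v 0 i| ^+ 4) /
  (\sum_i q i p * `|v 0 i| ^+ 2) ^+ 2.
Proof.
rewrite /hsc; congr (_ / _).
  rewrite quartic_sum_diag.
    by apply: eq_bigr => i _; rewrite cigar_curvature !eqxx.
  by move=> i j k l /negPf ijkl; rewrite cigar_curvature ijkl.
rewrite -(cigar_form tt) expr2 mulr_suml; apply: eq_bigr => i _.
rewrite mulr_suml; apply: eq_bigr => j _.
rewrite mulr_sumr; apply: eq_bigr => k _.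
rewrite mulr_sumr; apply: eq_bigr => l _.
by rewrite /=; ring.
Qed.

Lemma cigar_hsc_num_ge0 p v i : 0 <= beta i * q i p ^+ 3 * `|v 0 i| ^+ 4.
Proof.
by apply: mulr_ge0; [apply: mulr_ge0; [exact: ler0n|]|]; apply: exprn_ge0;
  rewrite ?cplx_cigar_ge0.
Qed.

Lemma cigar_semipositive_hsc : semipositive_hsc cigar_metric.
Proof.
move=> p v _; rewrite cigar_hsc; apply: divr_ge0.
  by apply: sumr_ge0 => i _; exact: cigar_hsc_num_ge0.
apply: exprn_ge0; apply: sumr_ge0 => i _; apply: mulr_ge0.
  exact: cplx_cigar_ge0.
exact: exprn_ge0.
Qed.

Lemma cigar_hsc_eq0 p v : v != 0 ->
  (hsc cigar_metric p v == 0) = [forall i, b i ==> (v 0 i == 0)].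
Proof.
move=> v0; rewrite cigar_hsc mulf_eq0 invr_eq0 expf_eq0 /=.
have := cigar_form_gt0 tt p v0; rewrite cigar_form => /lt0r_neq0/negPf ->.
rewrite orbF psumr_eq0; last by move=> i _; exact: cigar_hsc_num_ge0.
apply/allP/forallP => [H i|H i _].
  apply/implyP => bi; have := H i (mem_index_enum i).
  by rewrite bi mul1r mulf_eq0 !expf_eq0 /= normr_eq0 gt_eqF ?cplx_cigar_gt0.
apply/implyP => _; have := H i; case: (b i) => /=; last by rewrite !mul0r.
by move=> /eqP ->; rewrite normr0 expr0n mulr0.
Qed.

End cigar_metric.

(** * Rank *)

Section coordinate_subspace.
Context {K : fieldType} {n : nat} (A : pred 'I_n).

Definition coord_tuple : #|A|.-tuple 'rV[K]_n :=
  [tuple delta_mx 0 (enum_val i) | i < #|A|].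

Definition coord_vspace : {vspace 'rV[K]_n} := <<coord_tuple>>%VS.

Lemma coord_sumE (c : 'I_#|A| -> K) i : (\sum_j c j *: coord_tuple`_j) 0 i =
  \sum_(j | enum_val j == i) c j.
Proof.
rewrite summxE [RHS]big_mkcond; apply: eq_bigr => j _.
by rewrite -tnth_nth tnth_mktuple !mxE eqxx /= eq_sym; case: eqP => _; rewrite ?mulr1 ?mulr0.
Qed.

Lemma dim_coord_vspace : \dim coord_vspace = #|A|.
Proof.
rewrite -[RHS](size_tuple coord_tuple); apply/eqP/freeP => c c0 j.
have := congr1 (fun v : 'rV[K]_n => v 0 (enum_val j)) c0.
rewrite coord_sumE mxE (bigD1 j)//= big1 ?addr0// => k /andP[/eqP/enum_val_inj ->].
by rewrite eqxx.
Qed.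

Lemma memv_coord_vspace v : (v \in coord_vspace) = [forall i, ~~ A i ==> (v 0 i == 0)].
Proof.
apply/idP/forallP => [/coord_span -> i|H].
  apply/implyP => Ai; rewrite coord_sumE big1// => j /eqP ji.
  by have := enum_valP j; rewrite ji unfold_in (negPf Ai).
rewrite [v]row_sum_delta; apply: memv_suml => i _.
have [Ai|/(implyP (H i))/eqP ->] := boolP (A i); last by rewrite scale0r mem0v.
apply: memvZ; apply: memv_span; apply/mapP; exists (enum_rank_in Ai i).
  by rewrite mem_enum.
by rewrite enum_rankK_in.
Qed.

End coordinate_subspace.

Section cigar_rank.
Context {R : realType} {n : nat} (b : 'I_n -> bool).
Local Notation g := (@cigar_metric R n b).

Lemma cigar_eta p : Defs.eta g p = #|[pred i | ~~ b i]|.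
Proof.
apply/eqP; rewrite eqn_leq; apply/andP; split.
  apply/bigmax_leqP => k /asboolP[L <- L0].
  (* Any flat subspace lies in the span of the flat coordinates, whose dimension therefore bounds
     its own. *)
  rewrite -(@dim_coord_vspace (cplx R)); apply: dimvS; apply/subvP => v vL.
  rewrite memv_coord_vspace; have [->|v0] := eqVneq v 0.
    by apply/forallP => i; rewrite mxE eqxx implybT.
  have := cigar_hsc_eq0 b p v0; rewrite L0// eqxx => /esym/forallP bv.
  by apply/forallP => i; rewrite /= negbK; exact: bv.
have kn : (#|[pred i | ~~ b i]| < n.+1)%N by rewrite ltnS -[leqRHS]card_ord max_card.
apply: (@leq_bigmax_cond _ _ (fun k : 'I_n.+1 => k : nat) (Ordinal kn)).
apply/asboolP.
exists (coord_vspace [pred i | ~~ b i]); first exact: dim_coord_vspace.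
move=> v; rewrite memv_coord_vspace => /forallP bv v0; apply/eqP.
rewrite cigar_hsc_eq0//; apply/forallP => i.
by have := bv i; rewrite /= negbK.
Qed.

Lemma cigar_rplus : rplus g = #|[pred i | b i]|.
Proof.
rewrite /rplus /eta_min; case: ex_minnP => m /asboolP[p <-] _.
rewrite cigar_eta; have := cardC [pred i | b i]; rewrite card_ord => nE.
by apply: (canLR (addnK _)).
Qed.

End cigar_rank.

Lemma card_ord_lt (n k : nat) : (k <= n)%N -> #|[pred i : 'I_n | (i < k)%N]| = k.
Proof.
move=> kn; rewrite -sum1_card (big_ord_narrow (F := fun=> 1%N) kn).
by rewrite sum_nat_const card_ord muln1.
Qed.

(** * Completeness *)

Section path_integral.
Context {R : realType}.
Local Notation mu := (@lebesgue_measure R).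
Implicit Types (F f s : R -> R) (t : R).

Lemma itv_continuous_within f : (forall t, 0 <= t <= 1 -> {for t, continuous f}) ->
  {within `[0, 1], continuous f}.
Proof.
move=> cf; apply: continuous_in_subspaceT => t.
by rewrite inE /= in_itv /= => t01; exact: cf.
Qed.

Lemma itv_measurable f : (forall t, 0 <= t <= 1 -> {for t, continuous f}) ->
  measurable_fun (`[0, 1]%classic : set R) f.
Proof.
move=> cf; apply: subspace_continuous_measurable_fun => //.
exact: itv_continuous_within.
Qed.

(** By the fundamental theorem of calculus and |int f| <= int |f|. With s the speed of a path, this
    bounds its length from below by the increment of a function of gradient at most 1. *)
Lemma increment_le_integral F f s :
  (forall t, 0 <= t <= 1 -> is_derive t 1 F (f t)) ->
  (forall t, 0 <= t <= 1 -> {for t, continuous f}) ->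
  (forall t, 0 <= t <= 1 -> {for t, continuous s}) ->
  (forall t, 0 <= t <= 1 -> `|f t| <= s t) ->
  (`|F 1 - F 0|%:E <= \int[mu]_(t in `[0%R, 1%R]) (s t)%:E)%E.
Proof.
move=> dF cf cs fs.
have cF t : 0 <= t <= 1 -> {for t, continuous F}.
  by move=> /dF [/derivable1_diffP/differentiable_continuous].
have dFLR : derivable_oo_LRcontinuous F 0 1.
  split.
  + by move=> t; rewrite in_itv /= => /andP[t0 t1];
      have [] := dF t; rewrite ?(ltW t0) ?(ltW t1).
  + by apply: cvg_at_right_filter; apply: cF; rewrite lexx ler01.
  + by apply: cvg_at_left_filter; apply: cF; rewrite lexx ler01.
have F'f : {in `]0, 1[, derive1 F =1 f}.
  move=> t; rewrite in_itv /= => /andP[t0 t1]; rewrite derive1E.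
  by have [_] := dF t (ltac:(by rewrite (ltW t0) (ltW t1))).
have FE := continuous_FTC2 (@ltr01 R) (itv_continuous_within cf) dFLR F'f.
have -> : (`|F 1 - F 0|%:E = `|\int[mu]_(t in `[0%R, 1%R]) (f t)%:E|)%E.
  by rewrite FE.
have mf := itv_measurable cf; have ms := itv_measurable cs.
apply: (le_trans (le_abse_integral _ _ _)) => //; first exact/measurable_EFinP.
apply: ge0_le_integral => //.
- by apply: measurableT_comp => //; exact/measurable_EFinP.
- exact/measurable_EFinP.
Qed.

Lemma integral_le_cst s (K : R) : 
  (forall t, 0 <= t <= 1 -> {for t, continuous s}) ->
  (forall t, 0 <= t <= 1 -> 0 <= s t <= K) ->
  (\int[mu]_(t in `[0%R, 1%R]) (s t)%:E <= K%:E)%E.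
Proof.
move=> cs sK.
apply: (@le_trans _ _ (\int[mu]_(t in `[0%R, 1%R]) (cst K%:E) t)%E).
  apply: ge0_le_integral => //.
  - by move=> t; rewrite /= in_itv /= => /sK /andP[s0 _]; rewrite lee_fin.
  - by apply/measurable_EFinP; exact: itv_measurable.
  - by move=> t; rewrite /= in_itv /= => /sK /andP[s0 s1]; rewrite lee_fin.
rewrite integral_cst//= lebesgue_measure_itv /= lte_fin ltr01.
by rewrite -EFinD subr0 mule1.
Qed.

End path_integral.

(** * Lipschitz functions for the cigar distance *)

Section test_functions.
Context {R : realType}.
Local Notation C := (cplx R).
Implicit Types (z d : C) (t : R).

Definition normsq z : R := complex.Re z ^+ 2 + complex.Im z ^+ 2.

Definition rdot z d : R := complex.Re z * complex.Re d + complex.Im z * complex.Im d.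

Lemma normsq_ge0 z : 0 <= normsq z.
Proof. by rewrite addr_ge0 ?sqr_ge0. Qed.

(** Cauchy-Schwarz in the plane, by Lagrange's identity: the difference is the square of a
    determinant. *)
Lemma rdot_sqr_le z d : rdot z d ^+ 2 <= normsq z * normsq d.
Proof.
rewrite -subr_ge0 (_ : _ - _ =
  (complex.Re z * complex.Im d - complex.Im z * complex.Re d) ^+ 2) ?sqr_ge0//.
by rewrite /rdot /normsq; ring.
Qed.

Lemma cigarE b z : cigar b z * (1 + b%:R * normsq z) = 1.
Proof. by rewrite mulVf// gt_eqF// cigar_denom_gt0. Qed.

Lemma cigar_le1 b z : cigar b z <= 1.
Proof.
rewrite invf_le1 ?cigar_denom_gt0// lerDl mulr_ge0//.
exact: normsq_ge0.
Qed.

(* [f' z d] is the derivative of [f] at [z] in the direction [d]; the bound says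
   that it is at most four times the length of [d] in the cigar metric. *)
Record test_function b (f : C -> R) (f' : C -> C -> R) : Prop := TestFunction {
  test_derive : forall (c : R -> C) t d,
    is_cderive t c d -> is_derive t 1 (fun s => f (c s)) (f' (c t) d) ;
  test_continuous : forall (T : topologicalType) (c v : T -> C) (t : T),
    {for t, continuous c} -> {for t, continuous v} ->
    {for t, continuous (fun s => f' (c s) (v s))} ;
  test_bound : forall z d, f' z d ^+ 2 <= 16 * (cigar b z * normsq d)
}.

Section real_continuity.
Context {T : topologicalType} (t : T).
Implicit Types f h : T -> R.

Lemma continuous_add f h : {for t, continuous f} -> {for t, continuous h} ->
  {for t, continuous (fun s => f s + h s)}.
Proof. by move=> fc hc; apply: (@cvgD _ R^o _ (nbhs t) _). Qed.

Lemma continuous_mul f h : {for t, continuous f} -> {for t, continuous h} ->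
  {for t, continuous (fun s => f s * h s)}.
Proof. by move=> fc hc; apply: (@cvgM _ _ (nbhs t) _). Qed.

Lemma continuous_scale (k : R) f : {for t, continuous f} ->
  {for t, continuous (fun s => k * f s)}.
Proof. by move=> fc; apply: (@cvgMr _ _ (nbhs t) _). Qed.

Lemma continuous_opp f : {for t, continuous f} -> {for t, continuous (fun s => - f s)}.
Proof. by move=> fc; apply: (@cvgN _ R^o _ (nbhs t) _). Qed.

Lemma continuous_Re_comp (c : T -> C) : {for t, continuous c} ->
  {for t, continuous (fun s => complex.Re (c s))}.
Proof. by move=> cc; apply: (@continuous_comp T C R c) => //; exact: Re_continuous. Qed.

Lemma continuous_Im_comp (c : T -> C) : {for t, continuous c} ->
  {for t, continuous (fun s => complex.Im (c s))}.
Proof. by move=> cc; apply: (@continuous_comp T C R c) => //; exact: Im_continuous. Qed.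

Lemma continuous_cigar_comp b (c : T -> C) : {for t, continuous c} ->
  {for t, continuous (fun s => cigar b (c s))}.
Proof.
by move=> cc; apply: (@continuous_comp T C R c) => //; exact: cigar_real_continuous.
Qed.

Lemma continuous_normsq (c : T -> C) : {for t, continuous c} ->
  {for t, continuous (fun s => normsq (c s))}.
Proof.
move=> cc; rewrite (_ : (fun s => _) = fun s =>
  complex.Re (c s) * complex.Re (c s) + complex.Im (c s) * complex.Im (c s)) //.
by apply: continuous_add; apply: continuous_mul;
  solve [exact: continuous_Re_comp|exact: continuous_Im_comp].
Qed.

Lemma continuous_rdot (c v : T -> C) : {for t, continuous c} -> {for t, continuous v} ->
  {for t, continuous (fun s => rdot (c s) (v s))}.
Proof.
move=> cc vc; rewrite /rdot.
by apply: continuous_add; apply: continuous_mul;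
  solve [exact: continuous_Re_comp|exact: continuous_Im_comp].
Qed.

Lemma continuous_cigar_slope (b : bool) (c v : T -> C) :
  {for t, continuous c} -> {for t, continuous v} ->
  {for t, continuous (fun s => b%:R * cigar b (c s) ^+ 2 * (2 * rdot (c s) (v s)))}.
Proof.
move=> cc vc.
apply: (continuous_mul (f := fun s => b%:R * cigar b (c s) ^+ 2)
  (h := fun s => 2 * rdot (c s) (v s))).
  apply: (continuous_scale (f := fun s => cigar b (c s) ^+ 2)).
  by apply: (continuous_mul (f := fun s => cigar b (c s)));
    exact: continuous_cigar_comp.
apply: (continuous_scale (f := fun s => rdot (c s) (v s))).
exact: continuous_rdot.
Qed.

Lemma continuous_sum (I : Type) (r : seq I) (f : I -> T -> R) :
  (forall i, {for t, continuous (f i)}) ->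
  {for t, continuous (fun s => \sum_(i <- r) f i s)}.
Proof.
move=> fc; elim: r => [|i r IH].
  rewrite (_ : (fun s => _) = fun=> 0); first exact: cst_continuous.
  by apply/funext => s; rewrite big_nil.
rewrite (_ : (fun s => _) = fun s => f i s + \sum_(j <- r) f j s).
  exact: continuous_add.
by apply/funext => s; rewrite big_cons.
Qed.

End real_continuity.

Definition test_ln b z : R := ln (1 + b%:R * normsq z).
Definition test_ln' b z d : R := cigar b z * (b%:R * (2 * rdot z d)).
Definition test_Re b z : R := complex.Re z * cigar b z.
Definition test_Re' b z d : R := complex.Re d * cigar b z -
  complex.Re z * (b%:R * cigar b z ^+ 2 * (2 * rdot z d)).
Definition test_Im b z : R := complex.Im z * cigar b z.
Definition test_Im' b z d : R := complex.Im d * cigar b z -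
  complex.Im z * (b%:R * cigar b z ^+ 2 * (2 * rdot z d)).

(* With r = |z|^2, q = 1 / (1 + r) and S = rdot z d, so that S^2 <= r N and
   q r = 1 - q <= 1. *)
Lemma cigar_bound_ln (q r S N : R) : 0 < q -> q * (1 + r) = 1 -> 0 <= r ->
  0 <= N -> S ^+ 2 <= r * N -> (q * (2 * S)) ^+ 2 <= 16 * (q * N).
Proof.
move=> q0 qr r0 N0 SN.
have -> : (q * (2 * S)) ^+ 2 = 4 * q ^+ 2 * S ^+ 2 by ring.
have : q ^+ 2 * S ^+ 2 <= q ^+ 2 * (r * N) by rewrite ler_wpM2l ?sqr_ge0.
have -> : q ^+ 2 * (r * N) = (1 - q) * (q * N).
  by rewrite (_ : 1 - q = q * r); [ring|rewrite -qr; ring].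
have : 0 <= q * (q * N) by rewrite !mulr_ge0// ltW.
have : 0 <= q * N by rewrite mulr_ge0// ltW.
lra.
Qed.

(** Here x and x' are the same real coordinate of z and of d. The two terms A and B of the
    derivative of x q satisfy A^2 <= q N, since q <= 1, and B^2 <= 4 q N, since q r <= 1. Hence (A -
    B)^2 <= 2 A^2 + 2 B^2 <= 10 q N, and 16 is a convenient perfect square above 10. *)
Lemma cigar_bound_coord (q x r S x' N : R) : 0 < q -> q * (1 + r) = 1 ->
  x ^+ 2 <= r -> x' ^+ 2 <= N -> S ^+ 2 <= r * N ->
  (x' * q - x * (q ^+ 2 * (2 * S))) ^+ 2 <= 16 * (q * N).
Proof.
move=> q0 qr xr xN SN.
have r0 : 0 <= r by rewrite (le_trans _ xr) ?sqr_ge0.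
have N0 : 0 <= N by rewrite (le_trans _ xN) ?sqr_ge0.
have q1 : q <= 1.
  by rewrite -qr ler_peMr ?(ltW q0)// lerDl.
pose A := x' * q; pose B := x * (q ^+ 2 * (2 * S)).
have AN : A ^+ 2 <= q * N.
  rewrite /A exprMn mulrC expr2 -mulrA ler_pM2l//.
  by apply: le_trans (ler_piMl _ q1) xN; rewrite ?sqr_ge0.
have BN : B ^+ 2 <= 4 * (q * N).
  have -> : B ^+ 2 = 4 * (q ^+ 4 * (x ^+ 2 * S ^+ 2)) by rewrite /B; ring.
  rewrite ler_pM2l//.
  have : x ^+ 2 * S ^+ 2 <= r * (r * N) by rewrite ler_pM ?sqr_ge0.
  move=> /(ler_wpM2l (exprn_ge0 4 (ltW q0))) /le_trans; apply.
  have -> : q ^+ 4 * (r * (r * N)) = q * N * (q * (q * r) ^+ 2) by ring.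
  rewrite ler_piMr ?mulr_ge0 ?(ltW q0)//.
  rewrite mulr_ile1 ?exprn_ge0 ?mulr_ge0 ?(ltW q0)// exprn_ile1 ?mulr_ge0 ?(ltW q0)//.
  by rewrite -qr ler_pM2l// lerDr.
have -> : (A - B) ^+ 2 = 2 * A ^+ 2 + 2 * B ^+ 2 - (A + B) ^+ 2 by ring.
have := sqr_ge0 (A + B); have : 0 <= q * N by rewrite mulr_ge0// ltW.
lra.
Qed.

Lemma test_function_ln b : test_function b (test_ln b) (test_ln' b).
Proof.
split=> [c t d cd|T c v t cc vc|z d].
- have den := is_derive_cigar_denom b cd.
  have lnd := is_derive1_ln (cigar_denom_gt0 b (c t)).
  exact: (@is_derive1_comp R (@ln R)
    (fun s => 1 + b%:R * normsq (c s)) t _ _ lnd den).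
- apply: (continuous_mul (f := fun s => cigar b (c s))
    (h := fun s => b%:R * (2 * rdot (c s) (v s)))); first exact: continuous_cigar_comp.
  apply: (continuous_scale (f := fun s => 2 * rdot (c s) (v s))).
  apply: (continuous_scale (f := fun s => rdot (c s) (v s))).
  exact: continuous_rdot.
rewrite /test_ln'; have := cigarE b z; have := rdot_sqr_le z d.
have q0 := cigar_gt0 b z; case: b q0 => q0 H qE; rewrite ?mul1r ?mul0r ?mulr0 in qE *.
  by apply: cigar_bound_ln H; rewrite ?normsq_ge0.
by rewrite expr0n /= mulr_ge0// mulr_ge0 ?normsq_ge0// ltW.
Qed.

Lemma test_function_Re b : test_function b (test_Re b) (test_Re' b).
Proof.
split=> [c t d cd|T c v t cc vc|z d].
- have [cR _] := cd.
  apply: (is_derive_eq (is_deriveM cR (is_derive_cigar b cd))).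
  by rewrite /test_Re' /rdot /GRing.scale /=; ring.
- apply: (continuous_add (f := fun s => complex.Re (v s) * cigar b (c s))
    (h := fun s => - (complex.Re (c s) * (b%:R * cigar b (c s) ^+ 2 * (2 * rdot (c s) (v s)))))).
    apply: (continuous_mul (f := fun s => complex.Re (v s))).
      exact: continuous_Re_comp.
    exact: continuous_cigar_comp.
  apply: (continuous_opp (f := fun s => complex.Re (c s) * (b%:R * cigar b (c s) ^+ 2 * (2 * rdot (c s) (v s))))).
  apply: (continuous_mul (f := fun s => complex.Re (c s)) (h := fun s => b%:R * cigar b (c s) ^+ 2 * (2 * rdot (c s) (v s)))).
    exact: continuous_Re_comp.
  exact: continuous_cigar_slope.
rewrite /test_Re'; have := cigarE b z; have := rdot_sqr_le z d.
have q0 := cigar_gt0 b z; case: b q0 => q0 H qE; rewrite ?mul1r ?mul0r ?mulr0 ?addr0 in qE *.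
  by apply: cigar_bound_coord H; rewrite ?lerDl ?sqr_ge0.
rewrite subr0 mulr1 in qE *; rewrite qE mulr1 mul1r.
have := sqr_ge0 (complex.Im d); have := sqr_ge0 (complex.Re d); rewrite /normsq; lra.
Qed.

Lemma test_function_Im b : test_function b (test_Im b) (test_Im' b).
Proof.
split=> [c t d cd|T c v t cc vc|z d].
- have [_ cI] := cd.
  apply: (is_derive_eq (is_deriveM cI (is_derive_cigar b cd))).
  by rewrite /test_Im' /rdot /GRing.scale /=; ring.
- apply: (continuous_add (f := fun s => complex.Im (v s) * cigar b (c s))
    (h := fun s => - (complex.Im (c s) * (b%:R * cigar b (c s) ^+ 2 * (2 * rdot (c s) (v s)))))).
    apply: (continuous_mul (f := fun s => complex.Im (v s))).
      exact: continuous_Im_comp.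
    exact: continuous_cigar_comp.
  apply: (continuous_opp (f := fun s => complex.Im (c s) * (b%:R * cigar b (c s) ^+ 2 * (2 * rdot (c s) (v s))))).
  apply: (continuous_mul (f := fun s => complex.Im (c s)) (h := fun s => b%:R * cigar b (c s) ^+ 2 * (2 * rdot (c s) (v s)))).
    exact: continuous_Im_comp.
  exact: continuous_cigar_slope.
rewrite /test_Im'; have := cigarE b z; have := rdot_sqr_le z d.
have q0 := cigar_gt0 b z; case: b q0 => q0 H qE; rewrite ?mul1r ?mul0r ?mulr0 ?addr0 in qE *.
  by apply: cigar_bound_coord H; rewrite ?lerDr ?sqr_ge0.
rewrite subr0 mulr1 in qE *; rewrite qE mulr1 mul1r.
have := sqr_ge0 (complex.Im d); have := sqr_ge0 (complex.Re d); rewrite /normsq; lra.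
Qed.

End test_functions.

Section path_lipschitz.
Context {R : realType} {n : nat} (b : 'I_n -> bool).
Local Notation C := (cplx R).
Local Notation M := (affine_manifold (R := R) n).
Local Notation g := (@cigar_metric R n b).
Implicit Types (c : R -> M) (t : R) (i : 'I_n).

Definition coord_velocity c i t : C := cderive1 (fun s => (c s : 'rV[C]_n) 0 i) t.

Lemma C1_coord_derive c t i : C1_at c t ->
  is_cderive t (fun s => (c s : 'rV[C]_n) 0 i) (coord_velocity c i t).
Proof.
by move=> [_ /(_ tt i I) [/nbhs_singleton cd _]]; exact: cderivable1P.
Qed.

Lemma C1_coord_velocity_continuous c t i : C1_at c t ->
  {for t, continuous (coord_velocity c i)}.
Proof. by move=> [_ /(_ tt i I) []]. Qed.

Lemma C1_coord_continuous c t i : C1_at c t ->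
  {for t, continuous (fun s => (c s : 'rV[C]_n) 0 i)}.
Proof.
move=> [cc _]; apply: (@continuous_comp R 'rV[C]_n C c (fun z => z 0 i)) => //.
exact: coord_continuous.
Qed.

Lemma cigar_speedE c t : speed g c t =
  Num.sqrt (\sum_i cigar (b i) ((c t : 'rV[C]_n) 0 i) * normsq (coord_velocity c i t)).
Proof.
pose v : 'rV[C]_n := \row_i coord_velocity c i t.
have := cigar_form b tt (c t) v; rewrite /speed => E; congr Num.sqrt.
transitivity (complex.Re (\sum_i ((cigar (b i) ((c t : 'rV[C]_n) 0 i))%:C%C : C) *
    `|v 0 i| ^+ 2)).
  rewrite -E; congr complex.Re; apply: eq_bigr => i _; apply: eq_bigr => j _.
  by rewrite /v !mxE.
rewrite (_ : \sum_i _ = (\sum_i cigar (b i) ((c t : 'rV[C]_n) 0 i) *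
  normsq (coord_velocity c i t))%:C%C) //.
rewrite -[RHS]/((real_complex R) _) rmorph_sum; apply: eq_bigr => i _.
by rewrite rmorphM /v mxE -add_Re2_Im2.
Qed.

Lemma cigar_speed_continuous c t : C1_at c t -> {for t, continuous (speed g c)}.
Proof.
move=> cc; rewrite (_ : speed g c = Num.sqrt \o (fun t =>
  \sum_i cigar (b i) ((c t : 'rV[C]_n) 0 i) * normsq (coord_velocity c i t))); last first.
  by apply/funext => s; exact: cigar_speedE.
apply: (@continuous_comp R R R); last exact: sqrt_continuous.
apply: (@continuous_sum R R t) => i.
apply: (@continuous_mul R R t).
  by apply: (@continuous_cigar_comp R R t); exact: C1_coord_continuous.
by apply: (@continuous_normsq R R t); exact: C1_coord_velocity_continuous.
Qed.

Lemma cigar_speed_coord c t i :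
  cigar (b i) ((c t : 'rV[C]_n) 0 i) * normsq (coord_velocity c i t) <=
  speed g c t ^+ 2.
Proof.
have term_ge0 j : 0 <= cigar (b j) ((c t : 'rV[C]_n) 0 j) * normsq (coord_velocity c j t).
  by rewrite mulr_ge0 ?normsq_ge0// ltW// cigar_gt0.
rewrite cigar_speedE sqr_sqrtr ?sumr_ge0// (bigD1 i)//= lerDl.
exact: sumr_ge0.
Qed.

(** The distance is an infimum, so some path is shorter than e; the increment of f is estimated
    along it. *)
Lemma test_function_lipschitz i f f' (p q : M) (e : R) :
  test_function (b i) f f' -> (gdist g p q < e%:E)%E ->
  `|f ((q : 'rV[C]_n) 0 i) - f ((p : 'rV[C]_n) 0 i)| < 4 * e.
Proof.
move=> tf /ereal_inf_lt[_ [c [c01 [c0 c1]] <-]] ce.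
(* The factor 1/4 compensates the constant 16 = 4^2 of [test_bound]: the derivative of f / 4 along
   the path is at most the speed. *)
have H := @increment_le_integral R (fun t => 4^-1 * f ((c t : 'rV[C]_n) 0 i))
  (fun t => 4^-1 * f' ((c t : 'rV[C]_n) 0 i) (coord_velocity c i t)) (speed g c).
rewrite -ltr_pdivrMl// -lte_fin.
rewrite -[4^-1 in X in (X%:E < _)%E]gtr0_norm// -normrM mulrBr -c0 -c1.
apply: le_lt_trans ce; apply: H => t t01.
- have := test_derive tf (C1_coord_derive i (c01 _ t01)) => /(is_deriveZ 4^-1).
  exact.
- apply: (@continuous_scale R R t).
  apply: (test_continuous tf); first exact: C1_coord_continuous (c01 _ t01).
  exact: C1_coord_velocity_continuous (c01 _ t01).
- exact: cigar_speed_continuous (c01 _ t01).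
have s0 : 0 <= speed g c t by exact: sqrtr_ge0.
rewrite normrM gtr0_norm// ler_pdivrMl// -[leRHS]ger0_norm ?mulr_ge0//.
rewrite -ler_sqr ?nnegrE// !real_normK ?num_real// exprMn.
apply: le_trans (test_bound tf _ _) _.
by rewrite (_ : 4 ^+ 2 = 16) ?ler_pM2l ?cigar_speed_coord//; ring.
Qed.

End path_lipschitz.

(** * Convergence of Cauchy sequences *)

Section cigar_completeness.
Context {R : realType} {n : nat} (b : 'I_n -> bool).
Local Notation C := (cplx R).
Local Notation M := (affine_manifold (R := R) n).
Local Notation g := (@cigar_metric R n b).
Implicit Types (t : R) (i : 'I_n).

Lemma real_cauchy_cvg (a : nat -> R) :
  (forall e : R, 0 < e -> exists N : nat, forall i j : nat,
     (N <= i)%N -> (N <= j)%N -> `|a j - a i| < e) -> cvgn a.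
Proof.
move=> Ha; apply: R_complete; apply: cauchy_exP => e /Ha[N HN].
exists (a N); exists N => // m /= Nm.
by rewrite -ball_normE /ball_ /=; exact: HN.
Qed.

Lemma cauchy_test_cvg i f f' (u : nat -> M) : test_function (b i) f f' ->
  (forall e : R, 0 < e -> exists N : nat, forall k l : nat,
     (N <= k)%N -> (N <= l)%N -> (gdist g (u k) (u l) < e%:E)%E) ->
  cvgn (fun m => f ((u m : 'rV[C]_n) 0 i)).
Proof.
move=> tf Hu; apply: real_cauchy_cvg => e e0.
have [|N HN] := Hu (e / 4); first by rewrite divr_gt0.
exists N => k l Nk Nl; have := test_function_lipschitz tf (HN k l Nk Nl).
by rewrite mulrC divfK.
Qed.

(* The three test functions determine z: with D = 1 + b |z|^2, the first one is
   ln D and the other two are the coordinates of z / D. *)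
Lemma cauchy_coord_cvg i (u : nat -> M) :
  (forall e : R, 0 < e -> exists N : nat, forall k l : nat,
     (N <= k)%N -> (N <= l)%N -> (gdist g (u k) (u l) < e%:E)%E) ->
  cvgn (fun m => complex.Re ((u m : 'rV[C]_n) 0 i)) /\
  cvgn (fun m => complex.Im ((u m : 'rV[C]_n) 0 i)).
Proof.
move=> Hu.
have /cvg_ex[l ul] := cauchy_test_cvg (test_function_ln (b i)) Hu.
have /cvg_ex[x ux] := cauchy_test_cvg (test_function_Re (b i)) Hu.
have /cvg_ex[y uy] := cauchy_test_cvg (test_function_Im (b i)) Hu.
have exp_ul : expR (test_ln (b i) ((u m : 'rV[C]_n) 0 i)) @[m --> \oo] --> expR l.
  exact: (cvg_comp _ _ ul (@continuous_expR R l)).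
have DE (z : C) : cigar (b i) z * expR (test_ln (b i) z) = 1.
  by rewrite /test_ln lnK ?cigarE// posrE cigar_denom_gt0.
split; apply/cvg_ex.
  exists (x * expR l); rewrite (_ : (fun m => _) = fun m =>
    test_Re (b i) ((u m : 'rV[C]_n) 0 i) * expR (test_ln (b i) ((u m : 'rV[C]_n) 0 i))).
    exact: cvgM.
  by apply/funext => m; rewrite /test_Re -mulrA DE mulr1.
exists (y * expR l); rewrite (_ : (fun m => _) = fun m =>
  test_Im (b i) ((u m : 'rV[C]_n) 0 i) * expR (test_ln (b i) ((u m : 'rV[C]_n) 0 i))).
  exact: cvgM.
by apply/funext => m; rewrite /test_Im -mulrA DE mulr1.
Qed.

Definition segment_path (p q : 'rV[C]_n) : R -> M :=
  fun t => p + (t%:C%C : C) *: (q - p).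

Lemma segment_path_coord p q i :
  (fun s => (segment_path p q s : 'rV[C]_n) 0 i) =
  fun s => p 0 i + (s%:C%C : C) * (q - p) 0 i.
Proof. by apply/funext => s; rewrite !mxE. Qed.

Lemma segment_path_velocity p q i t :
  cderive1 (fun s => (segment_path p q s : 'rV[C]_n) 0 i) t = (q - p) 0 i.
Proof.
by rewrite segment_path_coord; exact: is_cderive_val (is_cderive_line _ _ _).
Qed.

Lemma segment_path_C1 p q t : C1_at (segment_path p q) t.
Proof.
split; first exact: rline_continuous.
move=> [] i _ /=; split.
  apply: filterE => s; rewrite segment_path_coord.
  exact: is_cderive_cderivable (is_cderive_line _ _ _).
rewrite (_ : cderive1 _ = fun=> (q - p) 0 i); first exact: cst_continuous.
by apply/funext => s; exact: segment_path_velocity.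
Qed.

(** The straight segment competes in the infimum, and since the weights are at most 1 its speed
    never exceeds its constant Euclidean speed. *)
Lemma cigar_gdist_le (p q : 'rV[C]_n) :
  (gdist g p q <= (Num.sqrt (\sum_i normsq (q 0 i - p 0 i)))%:E)%E.
Proof.
apply: (@le_trans _ _ (curve_length g (segment_path p q))).
  apply: ereal_inf_lbound; exists (segment_path p q) => //; split.
    by move=> t _; exact: segment_path_C1.
  split; first by rewrite /segment_path scale0r addr0.
  by rewrite /segment_path scale1r addrC subrK.
apply: integral_le_cst => t _; first exact: cigar_speed_continuous (segment_path_C1 _ _ _).
rewrite sqrtr_ge0 /= cigar_speedE ler_wsqrtr//.
apply: ler_sum => i _; rewrite /coord_velocity segment_path_velocity !mxE.
by rewrite ler_piMl ?normsq_ge0 ?cigar_le1.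
Qed.

Lemma cigar_complete : complete_metric g.
Proof.
move=> u Hu; have cvg_u i := cauchy_coord_cvg i Hu.
pose x : 'rV[C]_n := \row_i (Complex
  (limn (fun m => complex.Re ((u m : 'rV[C]_n) 0 i)))
  (limn (fun m => complex.Im ((u m : 'rV[C]_n) 0 i))) : C).
exists x => e e0.
(* The squared Euclidean distance to the candidate limit; its square root dominates the distance of
   g. *)
pose D m : R := \sum_i normsq (x 0 i - (u m : 'rV[C]_n) 0 i).
have D0 : D m @[m --> \oo] --> (0 : R).
  have -> : 0 = \sum_(i < n) (0 : R) by rewrite big1.
  apply: cvg_big => [|i _]; first exact: add_continuous.
  have [cR cI] := cvg_u i.
  rewrite (_ : (fun m => _) = fun m =>
    (limn (fun m => complex.Re ((u m : 'rV[C]_n) 0 i)) -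
       complex.Re ((u m : 'rV[C]_n) 0 i)) ^+ 2 +
    (limn (fun m => complex.Im ((u m : 'rV[C]_n) 0 i)) -
       complex.Im ((u m : 'rV[C]_n) 0 i)) ^+ 2); last first.
    by apply/funext => m; rewrite /normsq Re_sub Im_sub !mxE.
  have sq0 (a : nat -> R) : cvgn a -> (limn a - a m) ^+ 2 @[m --> \oo] --> (0 : R).
    move=> ca; rewrite -[X in _ --> X](mulr0 0) -[X in X * _](subrr (limn a)).
    rewrite -[X in _ * X](subrr (limn a)).
    by apply: cvgM; apply: cvgB => //; exact: cvg_cst.
  by rewrite -[X in _ --> X](addr0 0); apply: cvgD; exact: sq0.
have : Num.sqrt (D m) @[m --> \oo] --> (0 : R).
  rewrite -(sqrtr0 R); exact: (cvg_comp _ _ D0 (@sqrt_continuous R 0)).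
move=> /cvgrPdist_lt/(_ e e0)[N _ HN]; exists N => m Nm.
apply: le_lt_trans (cigar_gdist_le _ _) _; rewrite lte_fin.
by have := HN m Nm; rewrite sub0r normrN ger0_norm ?sqrtr_ge0.
Qed.

End cigar_completeness.

Theorem theorem1p4 (R : realType) (n : nat) (hn : (2 <= n)%N) :
  exists (M : complexManifold R n) (g : hermitianMetric M),
    kahler g /\ complete_metric g /\ semipositive_hsc g /\
    rplus g = ((n + 1) %/ 2)%N /\
    exists X : complexManifold R n, compactifies M X /\ ample (anticanonical X).
Proof.
pose b (i : 'I_n) := (i < (n + 1) %/ 2)%N.
exists (affine_manifold n), (cigar_metric b); split; first exact: cigar_kahler.
split; first exact: cigar_complete.
split; first exact: cigar_semipositive_hsc.
split.
  rewrite cigar_rplus card_ord_lt//.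
  (* There are enough coordinates: n + 1 <= 2 n gives floor((n + 1) / 2) <= n. *)
  rewrite -[leqRHS](mulnK n (isT : 0 < 2)%N) leq_div2r// muln2 -addnn leq_add2l.
  exact: ltnW hn.
exists (P1n_manifold n); split; first exact: affine_compactification.
exact: anticanonical_P1n_ample.
Qed.
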